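(* There is an algorithm for indexing necklaces of length $n$ over the alphabet $\{0,1\}$ which runs in time $\mathsf{poly}(n)$: on input $n$ and $j$, it outputs a string of the $j$-th necklace under some fixed bijection between $\{1,\ldots,N\}$ and the set of binary necklaces of length $n$ ($N$ their number), and outputs ''too large'' if $j>N$.
   Context: A necklace of length $n$ over an alphabet $\Sigma$ is an equivalence class of strings in $\Sigma^n$ under cyclic rotation: $x\sim y$ iff $x=x^1x^2$ and $y=x^2x^1$ for some strings $x^1,x^2$. *)

(* Defs.v *)
From Stdlib Require Import PArith.
From mathcomp Require Import all_boot.
Set Implicit Arguments. Unset Strict Implicit. Unset Printing Implicit Defensive.

(* x ~ y iff x = x1 x2 and y = x2 x1 for some split; splitting at position k
   (0 <= k <= n) gives x1 = take k x, x2 = drop k x, so y = rot k x. *)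
Definition neck_rel (n : nat) (x y : n.-tuple bool) : bool :=
  [exists k : 'I_n.+1, val y == drop k (val x) ++ take k (val x)].

Definition necklace_of (n : nat) (x : n.-tuple bool) : {set n.-tuple bool} :=
  [set y | neck_rel x y].

Definition necklaces (n : nat) : {set {set n.-tuple bool}} :=
  [set necklace_of x | x : n.-tuple bool].

Definition num_necklaces (n : nat) : nat := #|necklaces n|.

Inductive cell (W : Type) : Type :=
  | Blank | Bit of bool | Sep | Work of W.
Arguments Blank {W}. Arguments Bit {W}. Arguments Sep {W}.

Inductive move : Type := MoveL | MoveR | Stay.

(* Single-tape (two-way infinite) deterministic TM with finite state set and
   finite tape alphabet. Halting states are those with [halted q]; a halting
   state with [too_large q] means the output "too large". *)
Record TM : Type := mkTM {
  tm_state : finType;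
  tm_work : finType;
  tm_start : tm_state;
  tm_halted : tm_state -> bool;
  tm_too_large : tm_state -> bool;
  tm_delta : tm_state -> cell tm_work -> tm_state * cell tm_work * move
}.

(* Configuration: state, tape left of the head (nearest cell first), and tape
   from the head rightwards (head cell first); missing cells are blank. *)
Definition config (M : TM) : Type :=
  (tm_state M * seq (cell (tm_work M)) * seq (cell (tm_work M)))%type.

Definition step (M : TM) (c : config M) : config M :=
  let: (q, l, r) := c in
  if @tm_halted M q then c else
  let: (q', b, m) := @tm_delta M q (head Blank r) in
  let r' := b :: behead r in
  match m with
  | MoveL => (q', behead l, head Blank l :: r')
  | MoveR => (q', b :: l, behead r)
  | Stay => (q', l, r')
  end.

Definition run (M : TM) (k : nat) (c : config M) : config M := iter k (@step M) c.

Fixpoint bin_pos (p : positive) : seq bool :=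
  match p with
  | xI p' => true :: bin_pos p'
  | xO p' => false :: bin_pos p'
  | xH => [:: true]
  end.

Definition input_tape (W : Type) (n : nat) (j : positive) : seq (cell W) :=
  nseq n (Bit true) ++ Sep :: map Bit (bin_pos j).

Definition init_config (M : TM) (n : nat) (j : positive) : config M :=
  (@tm_start M, [::], input_tape (tm_work M) n j).

Fixpoint out_bits (W : Type) (s : seq (cell W)) : seq bool :=
  match s with
  | Bit b :: s' => b :: out_bits s'
  | _ => [::]
  end.

Definition cfg_state (M : TM) (c : config M) : tm_state M := c.1.1.
Definition cfg_output (M : TM) (c : config M) : seq bool := out_bits c.2.

(* Main.v *)
(** Order the binary words of length [n] lexicographically, represent a necklace by its
    least word, and list the necklaces by decreasing representative.  The [j]-th
    representative is the least word [w] such that fewer than [j] necklaces have all their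
    words above [w]; it is found bit by bit.

    Counting is needed only when no suffix of [w] is below [w] ([pren]).  By Burnside's
    lemma, [n] times the number of necklaces above [w] is the sum over [k] of the number of
    words fixed by the rotation by [k] whose rotations are all above [w]; such a word is a
    power of a word of length [d = gcd k n].  Let an automaton remember the longest prefix
    of [w] that is a suffix of what has been read, and die as soon as a window is not above
    [w].  When [w] is [pren], a mismatch sends it back to its initial state, so two runs on
    the same long word coincide, and the words of length [d] to be counted are the closed
    walks of length [d]; a linear recurrence gives their number.

    The Turing machine keeps four stacks on parallel tracks of its tape.  Values are trees in
    prefix code on the first track; the functions on them computed in polynomial time are
    closed under composition, pairing, case analysis and iteration with polynomially bounded
    intermediate results. *)
Require Import Defs.
From Stdlib Require Import PArith.
From mathcomp Require Import all_boot all_fingroup zmodp zify.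
Set Implicit Arguments. Unset Strict Implicit. Unset Printing Implicit Defensive.

(** * Turing machine fragments *)

(** The trace of a power of the transfer matrix counts pairs of a word and a state fixed by it,
    whereas Burnside's lemma asks for words. Coincidence of runs makes a nonempty word fix at most
    one state, so the numbers agree; it also makes a walk labelled by a proper power close already
    after one period. No representative begins with [u0], and the next letter is 1. Counts occur
    only as multiples of [n] and are compared with [n * j], which avoids division. The time must be
    polynomial in [n] alone although [j] is arbitrary, so the machine gives up on an index of more
    than [n + 1] digits; there are at most [2 ^ n] necklaces. *)

Definition track := 'I_4.
Definition wcell : finType := {ffun track -> option bool}.
Definition tcell := cell wcell.
Definition tape := (seq tcell * seq tcell)%type.

Definition write_move (b : tcell) (m : move) (t : tape) : tape :=
  let: (l, r) := t in
  let r' := b :: behead r in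
  match m with
  | MoveL => (behead l, head Blank l :: r')
  | MoveR => (b :: l, behead r)
  | Stay => (l, r')
  end.

(** A machine fragment with labelled exits: a step to [inr e] leaves through exit [e], so later
    control can depend on the result. *)
Record flow (E : Type) := Flow {
  fstate : finType;
  fstart : fstate;
  fdelta : fstate -> tcell -> (fstate + E) * tcell * move
}.

Inductive runs (E : Type) (Q : Type) (d : Q -> tcell -> (Q + E) * tcell * move) :
  Q -> tape -> nat -> E -> tape -> Prop :=
| RunsExit q t e b m :
    d q (head Blank t.2) = (inr e, b, m) -> runs d q t 1 e (write_move b m t)
| RunsStep q t q' b m k e t' :
    d q (head Blank t.2) = (inl q', b, m) ->
    runs d q' (write_move b m t) k e t' -> runs d q t k.+1 e t'.

Definition ev (E : Type) (F : flow E) t k e t' := runs (@fdelta E F) (fstart F) t k e t'.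

Definition act (E : Type) (g : tcell -> E * tcell * move) : flow E :=
  @Flow E unit tt (fun _ c => let: (e, b, m) := g c in (inr e, b, m)).

Lemma ev_act E (g : tcell -> E * tcell * move) t e b m t' :
  g (head Blank t.2) = (e, b, m) -> write_move b m t = t' -> ev (act g) t 1 e t'.
Proof. by move=> h <-; apply: RunsExit; rewrite /= h. Qed.

(** [E] is finite because the state set contains one copy of [G e] for each exit. The exiting step
    of [F] enters [G e] directly, so running times simply add. *)
Definition bind (E : finType) (E' : Type) (F : flow E) (G : E -> flow E') : flow E' :=
  @Flow E' (fstate F + {e : E & fstate (G e)})%type (inl (fstart F))
    (fun q c => match q with
     | inl q => let: (x, b, m) := fdelta q c in
        (match x with
         | inl q' => inl (inl q')
         | inr e => inl (inr (existT _ e (fstart (G e))))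
         end, b, m)
     | inr (existT e q) => let: (x, b, m) := fdelta q c in
        (match x with
         | inl q' => inl (inr (existT _ e q'))
         | inr e' => inr e'
         end, b, m)
     end).

Lemma ev_bind (E : finType) E' (F : flow E) (G : E -> flow E') t k e t1 k' e' t2 :
  ev F t k e t1 -> ev (G e) t1 k' e' t2 -> ev (bind F G) t (k + k') e' t2.
Proof.
move=> hF hG.
have {}hG : runs (fdelta (f := bind F G)) (inr (existT _ e (fstart (G e)))) t1 k' e' t2.
  rewrite /ev in hG; clear hF; elim: hG => {t1 k' e' t2} [q t1 e' b m h|q t1 q' b m k' e' t' h _ IH].
    by apply: RunsExit; rewrite /= h.
  by apply: RunsStep IH; rewrite /= h.
rewrite /ev; move: hG; rewrite /=.
elim: hF => {t k e t1} [q t e b m h|q t q' b m k e t' h _ IH] hG.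
  by rewrite add1n; apply: RunsStep hG; rewrite /= h.
by rewrite addSn; apply: RunsStep (IH hG); rewrite /= h.
Qed.

(** The loop variable lives in the finite control, one copy of the body per value; [push_body] and
    [shift] use it to carry a symbol along the tape. *)
Definition loop (S : finType) (E : Type) (F : S -> flow (S + E)) (s : S) : flow E :=
  @Flow E {s : S & fstate (F s)} (existT _ s (fstart (F s)))
    (fun q c => let: existT s q := q in
        let: (x, b, m) := fdelta q c in
        (match x with
         | inl q' => inl (existT _ s q')
         | inr (inl s') => inl (existT _ s' (fstart (F s')))
         | inr (inr e) => inr e
         end, b, m)).

Lemma ev_loop_exit (S : finType) E (F : S -> flow (S + E)) s t k e t' :
  ev (F s) t k (inr e) t' -> ev (loop F s) t k e t'.
Proof.
rewrite /ev /=; move: (fstart _) => q h.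
move ee : (inr e) h => e1 h; elim: h ee => {q t k e1 t'}.
  by move=> q t e1 b m h ee; subst e1; apply: RunsExit; rewrite /= h.
move=> q t q' b m k e1 t' h _ IH /IH IH'.
by apply: RunsStep IH'; rewrite /= h.
Qed.

Lemma ev_loop_next (S : finType) E (F : S -> flow (S + E)) s t k s' t1 k' e t2 :
  ev (F s) t k (inl s') t1 -> ev (loop F s') t1 k' e t2 ->
  ev (loop F s) t (k + k') e t2.
Proof.
move=> h1 h2; rewrite /ev /= in h1 *.
move: (fstart (F s)) h1 => q h1.
move ee : (inl s') h1 => e1 h1; elim: h1 ee h2 => {q t k e1 t1}.
  by move=> q t e1 b m h ee h2; subst e1; rewrite add1n; apply: RunsStep h2; rewrite /= h.
move=> q t q' b m k e1 t' h _ IH ee h2; subst e1.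
by rewrite addSn; apply: RunsStep (IH erefl h2); rewrite /= h.
Qed.

Definition machine (E : finType) (big : E -> bool) (F : flow E) : TM :=
  @mkTM (fstate F + E)%type wcell (inl (fstart F))
    (fun q => if q is inr _ then true else false)
    (fun q => if q is inr e then big e else false)
    (fun q c => if q is inl q then fdelta q c else (q, c, Stay)).

Lemma step_machine (E : finType) (big : E -> bool) (F : flow E) q t :
  let: (x, b, m) := fdelta q (head Blank t.2) in
  @step (machine big F) (inl q, t.1, t.2) =
    (x, (write_move b m t).1, (write_move b m t).2).
Proof.
by case: t => l r /=; rewrite /step /=; case: (fdelta _ _) => [[x b] []].
Qed.

Lemma run_halted (M : TM) k (c : config M) :
  @tm_halted M (cfg_state c) -> run k c = c.
Proof.
move=> h; elim: k => //= k ->.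
by case: c h => [[q l] r] /=; rewrite /cfg_state /= => ->.
Qed.

Lemma runs_machine (E : finType) (big : E -> bool) (F : flow E) q t k e t' :
  runs (@fdelta _ F) q t k e t' -> forall k', k <= k' ->
  @run (machine big F) k' (inl q, t.1, t.2) = (inr e, t'.1, t'.2).
Proof.
have runS (c : config (machine big F)) i : run i.+1 c = run i (step c).
  by rewrite /run iterSr.
elim=> {q t k e t'} [q t e b m h|q t q' b m k e t' h _ IH] [//|k'] hk;
  have := @step_machine E big F q t; rewrite h runS => -> //.
  by rewrite run_halted.
by rewrite IH.
Qed.

(* Track [i] of a tape half [l] holds the [i]-th stack, top in the cell nearest to the head. *)
Definition stacks := {ffun track -> seq bool}.

(** A blank counts as empty on all tracks, so an untouched tape is a valid zone; input and separator
    cells never belong to one. *)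
Definition dec (c : tcell) : option wcell :=
  match c with
  | Blank => Some [ffun=> None]
  | Work v => Some v
  | _ => None
  end.

Definition tops (s : stacks) : wcell := [ffun i => ohead (s i)].
Definition pops (s : stacks) : stacks := [ffun i => behead (s i)].

Fixpoint zone (l : seq tcell) (s : stacks) : Prop :=
  match l with
  | [::] => s = [ffun=> [::]]
  | c :: l' => dec c = Some (tops s) /\ zone l' (pops s)
  end.

Lemma zone_head l s : zone l s -> dec (head Blank l) = Some (tops s).
Proof.
case: l => [->|c l [] //] /=.
by congr Some; apply/ffunP=> i; rewrite !ffunE.
Qed.

Lemma zone_behead l s : zone l s -> zone (behead l) (pops s).
Proof. by case: l => [->|c l []] //=; apply/ffunP=> i; rewrite !ffunE. Qed.

Definition upd T (s : {ffun track -> T}) (a : track) (x : T) : {ffun track -> T} :=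
  [ffun i => if i == a then x else s i].

Lemma upd_same T (s : {ffun track -> T}) a x : upd s a x a = x.
Proof. by rewrite ffunE eqxx. Qed.

Lemma zone_cons v l s : v = tops s -> zone l (pops s) -> zone (Work v :: l) s.
Proof. by move=> ->. Qed.

Definition is_work (c : tcell) := if c is Work _ then true else false.
Definition decd (c : tcell) : wcell := odflt [ffun=> None] (dec c).

Lemma zone_decd l s : zone l s -> decd (head Blank l) = tops s.
Proof. by move=> hz; rewrite /decd (zone_head hz). Qed.

Definition goleft : flow unit := act (fun c => (tt, c, MoveL)).

Definition goright : flow unit :=
  loop (fun _ : unit => act (fun c =>
    if is_work c then (inl tt, c, MoveR) else (inr tt, c, Stay))) tt.

Lemma ev_goright vs l m r : ~~ is_work m ->
  ev goright (l, map (@Work wcell) vs ++ m :: r) (size vs).+1 tt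
     (catrev (map (@Work wcell) vs) l, m :: r).
Proof.
move=> hm; elim: vs l => [|v vs IH] l /=.
  by apply: ev_loop_exit; apply: ev_act; [rewrite /= (negbTE hm)|].
rewrite -[(size vs).+2]add1n; apply: ev_loop_next (IH _).
by apply: ev_act.
Qed.

(** Each cell exchanges its symbol for the carried bit, displacing the stack by one cell. Visited
    blanks become [Work] cells, so that [goright] does not stop before the end of the zone. *)
Definition push_body (a : track) (b : bool) : flow (bool + unit) :=
  act (fun c => let v := decd c in
    if v a is Some b' then (inl b', Work (upd v a (Some b)), MoveL)
    else (inr tt, Work (upd v a (Some b)), MoveR)).

Definition push (a : track) (b : bool) : flow unit :=
  bind goleft (fun _ => bind (loop (push_body a) b) (fun _ => goright)).

Lemma ev_push_loop a l s b R : zone l s ->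
  exists vs l',
    [/\ ev (loop (push_body a) b) (behead l, head Blank l :: R) (size (s a)).+1 tt
          (l', map (@Work wcell) vs ++ R),
       zone (catrev (map (@Work wcell) vs) l') (upd s a (b :: s a))
     & size vs = size (s a)].
Proof.
move en : (size (s a)) => n; elim: n => [|n IH] in l s b R en *; move=> hz.
  have sa : s a = [::] by apply/eqP; rewrite -size_eq0 en.
  exists [::], (Work (upd (tops s) a (Some b)) :: behead l).
  split=> //.
    apply: ev_loop_exit.
    apply: ev_act; [by rewrite /= (zone_decd hz) ffunE sa|by []].
  apply: zone_cons.
    by apply/ffunP=> i; rewrite !ffunE; case: eqP.
  suff -> : pops (upd s a (b :: s a)) = pops s by exact: zone_behead.
  by apply/ffunP=> i; rewrite !ffunE; case: eqP => // ->; rewrite sa.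
case sa : (s a) en => [|b' s'] //= [en].
have [|vs [l' [h1 h2 h3]]] := IH (behead l) (pops s) b'
   (Work (upd (tops s) a (Some b)) :: R) _ (zone_behead hz).
  by rewrite ffunE sa.
exists (rcons vs (upd (tops s) a (Some b))), l'.
split; last by rewrite size_rcons h3.
  rewrite -[n.+2]add1n; apply: (@ev_loop_next _ _ _ _ _ _ b'); last first.
    by rewrite map_rcons cat_rcons; exact: h1.
  apply: ev_act; [by rewrite /= (zone_decd hz) ffunE sa|by []].
rewrite catrevE map_rcons rev_rcons /= -catrevE.
split.
  by congr Some; apply/ffunP=> i; rewrite !ffunE; case: eqP.
suff -> : pops (upd s a [:: b, b' & s']) = upd (pops s) a (b' :: pops s a) by [].
by apply/ffunP=> i; rewrite !ffunE; case: eqP => //; rewrite sa.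
Qed.

(* A Hoare triple with a time bound [k]; the right half of the tape is a frame, and its
   first cell marks the end of the zone for the sweeps of [push] and [pop]. *)
Record sev (E : Type) (F : flow E) (s : stacks) (k : nat) (e : E) (s' : stacks) : Prop :=
  Sev { sevP : forall l m r, zone l s -> ~~ is_work m ->
  exists l' k', [/\ k' <= k, zone l' s' & ev F (l, m :: r) k' e (l', m :: r)] }.

Lemma sev_le E (F : flow E) s k k' e s' :
  sev F s k e s' -> k <= k' -> sev F s k' e s'.
Proof.
move=> h hk; split=> l m r hz hm; have [l' [k1 [h1 h2 h3]]] := sevP h r hz hm.
by exists l', k1; split=> //; apply: leq_trans hk.
Qed.

Lemma sev_bind (E : finType) E' (F : flow E) (G : E -> flow E') s k e s1 k' e' s2 :
  sev F s k e s1 -> sev (G e) s1 k' e' s2 -> sev (bind F G) s (k + k') e' s2.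
Proof.
move=> h1 h2; split=> l m r hz hm.
have [l1 [k1 [a1 b1 c1]]] := sevP h1 r hz hm.
have [l2 [k2 [a2 b2 c2]]] := sevP h2 r b1 hm.
exists l2, (k1 + k2); split=> //; first exact: leq_add.
exact: ev_bind c1 c2.
Qed.

Lemma sev_loop_exit (S : finType) E (F : S -> flow (S + E)) x s k e s' :
  sev (F x) s k (inr e) s' -> sev (loop F x) s k e s'.
Proof.
move=> h; split=> l m r hz hm; have [l1 [k1 [a1 b1 c1]]] := sevP h r hz hm.
by exists l1, k1; split=> //; apply: ev_loop_exit.
Qed.

Lemma sev_loop_next (S : finType) E (F : S -> flow (S + E)) x s k x' s1 k' e s2 :
  sev (F x) s k (inl x') s1 -> sev (loop F x') s1 k' e s2 ->
  sev (loop F x) s (k + k') e s2.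
Proof.
move=> h1 h2; split=> l m r hz hm.
have [l1 [k1 [a1 b1 c1]]] := sevP h1 r hz hm.
have [l2 [k2 [a2 b2 c2]]] := sevP h2 r b1 hm.
exists l2, (k1 + k2); split=> //; first exact: leq_add.
exact: ev_loop_next c1 c2.
Qed.

Definition ret E (e : E) : flow E := act (fun c => (e, c, Stay)).

Lemma sev_ret E (e : E) s : sev (ret e) s 1 e s.
Proof. by split=> l m r hz hm; exists l, 1; split=> //; apply: ev_act. Qed.

Lemma sev_push a b s :
  sev (push a b) s (2 * size (s a) + 3) tt (upd s a (b :: s a)).
Proof.
split=> l m r hz hm.
have [vs [l' [h1 h2 h3]]] := ev_push_loop a b (m :: r) hz.
exists (catrev (map (@Work wcell) vs) l'), (1 + ((size (s a)).+1 + (size vs).+1)).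
split=> //; first by rewrite h3; lia.
apply: ev_bind; last first.
  by apply: ev_bind; [exact: h1|exact: ev_goright].
exact: ev_act.
Qed.

(** Popping displaces the stack towards the head, so it has to start from the far end. *)
Definition seek (a : track) : flow unit :=
  loop (fun _ : unit => act (fun c => let v := decd c in
    if v a is Some _ then (inl tt, Work v, MoveL) else (inr tt, Work v, MoveR))) tt.

Definition shift (a : track) : flow (option bool) :=
  loop (fun o : option bool => act (fun c =>
    if c is Work v then (inl (v a), Work (upd v a o), MoveR) else (inr o, c, Stay))) None.

Definition pop (a : track) : flow (option bool) :=
  bind goleft (fun _ => bind (seek a) (fun _ => shift a)).

Fixpoint shifted (a : track) (o : option bool) (vs : seq wcell) (l : seq tcell) :=
  if vs is v :: vs' then shifted a (v a) vs' (Work (upd v a o) :: l) else (l, o).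

Lemma shifted_rcons a o vs v l :
  shifted a o (rcons vs v) l =
  (Work (upd v a (shifted a o vs l).2) :: (shifted a o vs l).1, v a).
Proof. by elim: vs o l => //= x vs IH o l; rewrite IH. Qed.

Lemma ev_shift a vs l m r : ~~ is_work m ->
  ev (shift a) (l, map (@Work wcell) vs ++ m :: r) (size vs).+1
   (shifted a None vs l).2 ((shifted a None vs l).1, m :: r).
Proof.
rewrite /shift => hm; elim: vs None l => [|v vs IH] o l /=.
  by apply: ev_loop_exit; apply: ev_act => /=; case: m hm.
rewrite -[(size vs).+2]add1n; apply: ev_loop_next (IH _ _).
by apply: ev_act.
Qed.

Lemma ev_seek a l s R : zone l s ->
  exists vs l',
    [/\ ev (seek a) (behead l, head Blank l :: R) (size (s a)).+1 tt
          (l', map (@Work wcell) vs ++ R),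
       zone (shifted a None vs l').1 (upd s a (behead (s a))),
       (shifted a None vs l').2 = ohead (s a)
     & size vs = size (s a)].
Proof.
move en : (size (s a)) => n; elim: n => [|n IH] in l s R en *; move=> hz.
  have sa : s a = [::] by apply/eqP; rewrite -size_eq0 en.
  exists [::], (Work (tops s) :: behead l).
  split=> //=; last by rewrite sa.
    apply: ev_loop_exit.
    apply: ev_act; [by rewrite /= (zone_decd hz) ffunE sa|by []].
  split.
    congr Some; apply/ffunP=> i; rewrite !ffunE.
    by case: eqP => [->|//]; rewrite sa.
  suff -> : pops (upd s a (behead (s a))) = pops s by exact: zone_behead.
  by apply/ffunP=> i; rewrite !ffunE; case: eqP => // ->; rewrite sa.
case sa : (s a) en => [|b' s'] //= [en].
have [|vs [l' [h1 h2 h3 h4]]] := IH (behead l) (pops s)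
   (Work (tops s) :: R) _ (zone_behead hz).
  by rewrite ffunE sa.
exists (rcons vs (tops s)), l'.
rewrite size_rcons h4; split=> //.
- rewrite -[n.+2]add1n; apply: (@ev_loop_next _ _ _ _ _ _ tt); last first.
    by rewrite map_rcons cat_rcons; exact: h1.
  apply: ev_act; [by rewrite /= (zone_decd hz) ffunE sa|by []].
- rewrite shifted_rcons /=; split.
    congr Some; apply/ffunP=> i; rewrite !ffunE.
    by rewrite h3 ffunE sa; case: eqP.
  suff -> : pops (upd s a s') = upd (pops s) a (behead (pops s a)) by [].
  by apply/ffunP=> i; rewrite !ffunE; case: eqP => //; rewrite sa.
- by rewrite shifted_rcons /= ffunE sa.
Qed.

Lemma sev_pop a s :
  sev (pop a) s (2 * size (s a) + 3) (ohead (s a)) (upd s a (behead (s a))).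
Proof.
split=> l m r hz hm.
have [vs [l' [h1 h2 h3 h4]]] := ev_seek a (m :: r) hz.
exists (shifted a None vs l').1, (1 + ((size (s a)).+1 + (size vs).+1)).
split=> //; first by rewrite h4; lia.
apply: ev_bind; last first.
  by apply: ev_bind; [exact: h1|rewrite -h3; exact: ev_shift].
exact: ev_act.
Qed.

(** * Trees on the tape *)

Definition tA : track := @Ordinal 4 0 isT.
Definition tB : track := @Ordinal 4 1 isT.
Definition tC : track := @Ordinal 4 2 isT.
Definition tD : track := @Ordinal 4 3 isT.

Definition mk (A B C D : seq bool) : stacks :=
  [ffun i : track => nth [::] [:: A; B; C; D] i].

Notation main A := (mk A [::] [::] [::]).

Lemma mkE A B C D :
  (mk A B C D tA = A) * (mk A B C D tB = B) * (mk A B C D tC = C) * (mk A B C D tD = D).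
Proof. by rewrite !ffunE. Qed.

Lemma updE A B C D X :
  (upd (mk A B C D) tA X = mk X B C D) * (upd (mk A B C D) tB X = mk A X C D) *
  (upd (mk A B C D) tC X = mk A B X D) * (upd (mk A B C D) tD X = mk A B C X).
Proof.
by do !split; apply/ffunP=> -[[|[|[|[|i]]]] hi] //; rewrite !ffunE.
Qed.

Lemma sev_push_le a b (s s' : stacks) M : size (s a) <= M -> upd s a (b :: s a) = s' ->
  sev (push a b) s (2 * M + 3) tt s'.
Proof. by move=> h <-; apply: (sev_le (sev_push _ _ _)); rewrite ?mkE; lia. Qed.

Lemma sev_pop_le a o (s s' : stacks) M : size (s a) <= M -> ohead (s a) = o ->
  upd s a (behead (s a)) = s' -> sev (pop a) s (2 * M + 3) o s'.
Proof. by move=> h <- <-; apply: (sev_le (sev_pop _ _)); rewrite ?mkE; lia. Qed.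

Ltac stk := rewrite ?mkE ?updE //=.

Definition seqf E (F : flow unit) (G : flow E) : flow E := bind F (fun _ => G).

Lemma sev_seqf E (F : flow unit) (G : flow E) s k s1 k' e s2 :
  sev F s k tt s1 -> sev G s1 k' e s2 -> sev (seqf F G) s (k + k') e s2.
Proof. exact: sev_bind. Qed.

Inductive tree := Lf | Nd of tree & tree.

Fixpoint code (t : tree) : seq bool :=
  if t is Nd a b then true :: code a ++ code b else [:: false].

Definition push2 (fB fD : bool) (b : bool) : flow unit :=
  seqf (if fB then push tB b else ret tt) (if fD then push tD b else ret tt).

Definition grab_body (fB fD : bool) (_ : unit) : flow (unit + unit) :=
  bind (pop tA) (fun o : option bool =>
    if o is Some b then
      seqf (push2 fB fD b)
        (if b then seqf (push tC true) (ret (inl tt))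
         else bind (pop tC) (fun o => ret (if o is Some _ then inl tt else inr tt)))
    else ret (inr tt)).

(* The counter on track C tells where the prefix code of a tree ends. *)
Definition grab (fB fD : bool) : flow unit := loop (grab_body fB fD) tt.

Definition ext (f : bool) (xs B : seq bool) := if f then catrev xs B else B.
Arguments ext : simpl never.

Lemma sev_push2 fB fD b A B C D M : size B <= M -> size D <= M ->
  sev (push2 fB fD b) (mk A B C D) (4 * M + 6) tt
    (mk A (ext fB [:: b] B) C (ext fD [:: b] D)).
Proof.
move=> hB hD.
have -> : 4 * M + 6 = (2 * M + 3) + (2 * M + 3) by lia.
apply: (@sev_seqf _ _ _ _ _ (mk A (ext fB [:: b] B) C D)).
  by case: fB; [apply: sev_push_le; stk|apply: (sev_le (sev_ret _ _)); rewrite ?mkE; lia].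
by case: fD; [apply: sev_push_le; stk|apply: (sev_le (sev_ret _ _)); rewrite ?mkE; lia].
Qed.

Definition grab_cost M := 8 * M + 13.
Arguments grab_cost : simpl never.

Lemma sev_grab_node fB fD A B C D M :
  size A < M -> size B <= M -> size C <= M -> size D <= M ->
  sev (grab_body fB fD tt) (mk (true :: A) B C D) (grab_cost M) (inl tt)
    (mk A (ext fB [:: true] B) (true :: C) (ext fD [:: true] D)).
Proof.
move=> hA hB hC hD.
have -> : grab_cost M = (2 * M + 3) + ((4 * M + 6) + ((2 * M + 3) + 1)) by rewrite /grab_cost; lia.
apply: (sev_bind (e := Some true)); first by apply: sev_pop_le; stk.
apply: sev_seqf; first exact: sev_push2.
apply: sev_seqf; last exact: sev_ret.
by apply: sev_push_le; stk.
Qed.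

Lemma sev_grab_leaf fB fD A B C D M :
  size A < M -> size B <= M -> size C <= M -> size D <= M ->
  sev (grab_body fB fD tt) (mk (false :: A) B C D) (grab_cost M)
    (if C is [::] then inr tt else inl tt)
    (mk A (ext fB [:: false] B) (behead C) (ext fD [:: false] D)).
Proof.
move=> hA hB hC hD.
have -> : grab_cost M = (2 * M + 3) + ((4 * M + 6) + ((2 * M + 3) + 1)) by rewrite /grab_cost; lia.
apply: (sev_bind (e := Some false)); first by apply: sev_pop_le; stk.
apply: sev_seqf; first exact: sev_push2.
apply: (sev_bind (e := ohead C)); first by apply: sev_pop_le; stk.
by case: C {hC} => [|c C]; apply: sev_ret.
Qed.

Lemma ext_cat f xs ys B : ext f (xs ++ ys) B = ext f ys (ext f xs B).
Proof. by case: f => //; rewrite /ext catrev_catl. Qed.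

Lemma size_ext f xs B : size (ext f xs B) <= size xs + size B.
Proof. by rewrite /ext; case: f => /=; rewrite ?catrevE ?size_cat ?size_rev; lia. Qed.

(** In continuation form: with a token left on track C the end of the subtree [t] does not end the
    loop, whose remaining run is the last hypothesis. *)
Lemma sev_grab_next fB fD t A B C D M k s' :
  size (code t) + size A + size B <= M -> size (code t) + size A + size C < M ->
  size (code t) + size A + size D <= M ->
  sev (grab fB fD) (mk A (ext fB (code t) B) C (ext fD (code t) D)) k tt s' ->
  sev (grab fB fD) (mk (code t ++ A) B (true :: C) D)
    (size (code t) * grab_cost M + k) tt s'.
Proof.
elim: t A B C D k => [|a IHa b IHb] A B C D k /= hB hC hD h.
  rewrite mul1n; apply: sev_loop_next h.
  by apply: sev_grab_leaf => //=; lia.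
rewrite size_cat in hB hC hD *.
rewrite [_.+1 * grab_cost M]mulSn mulnDl -(addnA (grab_cost M)) -(addnA (size (code a) * _)); apply: sev_loop_next.
  by apply: sev_grab_node => //; rewrite ?size_cat /=; lia.
have sB := size_ext fB [:: true] B; have sD := size_ext fD [:: true] D.
have sB' := size_ext fB (code a) (ext fB [:: true] B).
have sD' := size_ext fD (code a) (ext fD [:: true] D).
simpl in *.
rewrite -catA; apply: IHa; rewrite ?size_cat /=; try lia.
apply: IHb; try lia.
by rewrite -!ext_cat.
Qed.

(** The tokens on C stand for right subtrees still to be read. The last leaf finds none, which is
    the exit. *)
Lemma sev_grab fB fD t A B D M :
  size (code t) + size A + size B <= M -> size (code t) + size A + size D <= M ->
  sev (grab fB fD) (mk (code t ++ A) B [::] D)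
    (size (code t) * grab_cost M) tt (mk A (ext fB (code t) B) [::] (ext fD (code t) D)).
Proof.
elim: t A B D => [|a IHa b IHb] A B D /= hB hD.
  rewrite mul1n; apply: sev_loop_exit.
  by apply: (@sev_grab_leaf _ _ _ _ [::]) => //=; lia.
rewrite size_cat in hB hD *.
rewrite [_.+1 * grab_cost M]mulSn mulnDl; apply: sev_loop_next.
  by apply: sev_grab_node => //; rewrite ?size_cat /=; lia.
have sB := size_ext fB [:: true] B; have sD := size_ext fD [:: true] D.
have sB' := size_ext fB (code a) (ext fB [:: true] B).
have sD' := size_ext fD (code a) (ext fD [:: true] D).
simpl in *.
rewrite -catA; apply: sev_grab_next; rewrite ?size_cat /=; [lia|lia|lia|].
have e : forall f X, ext f (true :: code a ++ code b) X = ext f (code b) (ext f (code a) (ext f [:: true] X)).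
  by move=> f X; rewrite -!ext_cat.
by rewrite !e; apply: IHb; lia.
Qed.

Definition unload (a : track) : flow unit :=
  loop (fun _ : unit => bind (pop a) (fun o : option bool =>
    if o is Some b then seqf (push tA b) (ret (inl tt)) else ret (inr tt))) tt.

Lemma sev_unload a (s : stacks) M : a != tA -> size (s a) + size (s tA) <= M ->
  sev (unload a) s ((size (s a)).+1 * (4 * M + 7)) tt
    (upd (upd s tA (catrev (s a) (s tA))) a [::]).
Proof.
move=> ha; move en : (s a) => xs; elim: xs s en => [|x xs IH] s en hM.
  rewrite mul1n; apply: sev_loop_exit.
  have -> : 4 * M + 7 = (2 * M + 3) + (2 * M + 4) by lia.
  apply: (sev_bind (e := None) (s1 := upd s a [::])).
    by apply: sev_pop_le; rewrite ?en //=; rewrite /= in hM; lia.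
  rewrite /=.
  have -> : upd (upd s tA (s tA)) a [::] = upd s a [::].
    by apply/ffunP=> i; rewrite !ffunE; case: eqP => // _; case: eqP => // ->.
  by apply: (sev_le (sev_ret _ _)); rewrite ?mkE; lia.
rewrite /= mulSn; apply: sev_loop_next.
  have -> : 4 * M + 7 = (2 * M + 3) + ((2 * M + 3) + 1) by lia.
  apply: (sev_bind (e := Some x) (s1 := upd s a xs)).
    by apply: sev_pop_le; rewrite ?en //=; rewrite /= in hM; lia.
  apply: sev_seqf; last exact: sev_ret.
  apply: sev_push_le; last by [].
  by rewrite ffunE eq_sym (negbTE ha); rewrite /= in hM; lia.
have := IH (upd (upd s a xs) tA (x :: (upd s a xs) tA)).
have e1 : (upd s a xs) tA = s tA by rewrite ffunE eq_sym (negbTE ha).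
rewrite e1 upd_same.
have -> : upd (upd s a xs) tA (x :: s tA) a = xs by rewrite !ffunE (negbTE ha) eqxx.
move=> /(_ erefl) h.
have -> : upd (upd s tA (catrev xs (x :: s tA))) a [::] =
  upd (upd (upd (upd s a xs) tA (x :: s tA)) tA (catrev xs (x :: s tA))) a [::].
  apply/ffunP=> i; rewrite !ffunE; case: eqP => // _.
  by case: eqP.
apply: h; rewrite /= in hM *; lia.
Qed.

(** * Duplicating, exchanging and discarding trees *)

Definition dup : flow unit := seqf (grab true true) (seqf (unload tB) (unload tD)).
Definition swap : flow unit :=
  seqf (grab true false) (seqf (grab false true) (seqf (unload tB) (unload tD))).
Definition drop_top : flow unit := grab false false.

(** A crude common bound: linearly many stack operations of linear cost each. *)
Definition op_cost n := 100 * (n.+1 * n.+1).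

Lemma sev_dup t A : let n := size (code t) + size A in
  sev dup (main (code t ++ A)) (op_cost n) tt (main (code t ++ code t ++ A)).
Proof.
move=> n.
apply: (@sev_le _ _ _ (size (code t) * grab_cost n + ((size (code t)).+1 * (4 * n + 7) +
   (size (code t)).+1 * (4 * (2 * n) + 7)))); last first.
  rewrite /op_cost /grab_cost /n; move: (size _) (size _) => a b; nia.
apply: sev_seqf; first by apply: sev_grab; rewrite /=; lia.
have uB := @sev_unload tB (mk A (rev (code t)) [::] (rev (code t))) n isT.
have uD := @sev_unload tD (mk (code t ++ A) [::] [::] (rev (code t))) (2 * n) isT.
rewrite !mkE !updE size_rev !catrevE !revK in uB uD.
apply: sev_seqf; first by apply: uB.
by apply: uD; rewrite size_cat; lia.
Qed.

Lemma sev_swap t1 t2 A : let n := size (code t1) + size (code t2) + size A in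
  sev swap (main (code t1 ++ code t2 ++ A)) (op_cost n) tt (main (code t2 ++ code t1 ++ A)).
Proof.
move=> n.
apply: (@sev_le _ _ _ (size (code t1) * grab_cost n + (size (code t2) * grab_cost n +
  ((size (code t1)).+1 * (4 * n + 7) + (size (code t2)).+1 * (4 * n + 7))))); last first.
  rewrite /op_cost /grab_cost /n; move: (size _) (size _) (size _) => a b c; nia.
apply: sev_seqf; first by apply: sev_grab; rewrite ?size_cat /=; lia.
apply: sev_seqf; first by apply: sev_grab; rewrite /= ?catrevE ?size_cat ?size_rev /=; lia.
have uB := @sev_unload tB (mk A (rev (code t1)) [::] (rev (code t2))) n isT.
have uD := @sev_unload tD (mk (code t1 ++ A) [::] [::] (rev (code t2))) n isT.
rewrite !mkE !updE !size_rev !catrevE !revK in uB uD.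
apply: sev_seqf; first by apply: uB; lia.
by apply: uD; rewrite size_cat; lia.
Qed.

Lemma sev_drop t A : let n := size (code t) + size A in
  sev drop_top (main (code t ++ A)) (op_cost n) tt (main A).
Proof.
move=> n.
apply: (@sev_le _ _ _ (size (code t) * grab_cost n)); last first.
  rewrite /op_cost /grab_cost /n; move: (size _) (size _) => a b; nia.
by apply: sev_grab; rewrite /=; lia.
Qed.

(** * Polynomial-time functions *)

(** The base is at least 2 even for [n = 0], so constants and sums are absorbed by raising the
    exponent. *)
Definition bnd k n := n.+2 ^ k.

Lemma bnd_mono k m n : m <= n -> bnd k m <= bnd k n.
Proof. by move=> h; case: k => // k; rewrite /bnd leq_exp2r. Qed.

Lemma bnd_monok k k' n : k <= k' -> bnd k n <= bnd k' n.
Proof. by move=> h; rewrite /bnd leq_exp2l. Qed.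

Lemma bnd_le k n : bnd k n <= 2 ^ k * n.+1 ^ k.
Proof. by rewrite -expnMn; case: k => // k; rewrite /bnd leq_exp2r //; lia. Qed.

Definition polyb (p : nat -> nat) := exists k, forall n, p n <= bnd k n.

Lemma polyb_const c : polyb (fun _ => c).
Proof.
exists c => n; apply: leq_trans (ltnW (ltn_expl c (isT : 1 < 2))) _.
by rewrite /bnd; case: c => // c; rewrite leq_exp2r.
Qed.

Lemma polyb_id : polyb (fun n => n).
Proof. by exists 1 => n; rewrite /bnd expn1; lia. Qed.

Lemma polyb_add p q : polyb p -> polyb q -> polyb (fun n => p n + q n).
Proof.
move=> [a ha] [b hb]; exists (a + b).+1 => n.
have := bnd_monok n (leq_addr b a); have := bnd_monok n (leq_addl a b).
have -> : bnd (a + b).+1 n = n.+2 * bnd (a + b) n by rewrite /bnd expnS.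
move: (ha n) (hb n).
by move: (bnd a n) (bnd b n) (bnd (a + b) n) => x y z; move: (p n) (q n) => u v; nia.
Qed.

Lemma polyb_mul p q : polyb p -> polyb q -> polyb (fun n => p n * q n).
Proof.
by move=> [a ha] [b hb]; exists (a + b) => n; rewrite /bnd expnD leq_mul.
Qed.

Lemma polyb_bnd k p : polyb p -> polyb (fun n => bnd k (p n)).
Proof.
move=> [a ha]; exists (a.+2 * k) => n; rewrite /bnd expnM.
case: k => // k; rewrite leq_exp2r //.
have := ha n; rewrite /bnd !expnS.
have : 0 < n.+2 ^ a by rewrite expn_gt0.
by move: (n.+2 ^ a) => x; nia.
Qed.

Lemma polyb_succ p : polyb p -> polyb (fun n => (p n).+1).
Proof.
move=> hp; have [k hk] := polyb_add hp (polyb_const 1).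
by exists k => n; rewrite -addn1.
Qed.

Lemma polyb_op p : polyb p -> polyb (fun n => op_cost (p n)).
Proof.
move=> hp; apply: polyb_mul; first exact: polyb_const.
by apply: polyb_mul; apply: polyb_succ.
Qed.

Ltac polyb := repeat first [assumption | exact: polyb_id | exact: polyb_const
  | apply: polyb_add | apply: polyb_mul | apply: polyb_bnd | apply: polyb_op | apply: polyb_succ ].

Class Enc (T : Type) := enc : T -> tree.
#[global] Hint Mode Enc ! : typeclass_instances.

(** Encodings coincide where possible: [n.+1] has the code of [(tt, n)], a number that of a list of
    units, a nonempty list that of the pair of its head and tail. Such changes of view cost nothing
    ([ptime_coerce]). *)
#[global] Instance enc_unit : Enc unit := fun _ => Lf.
#[global] Instance enc_bool : Enc bool := fun b => if b then Nd Lf Lf else Lf.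
#[global] Instance enc_nat : Enc nat := fun n => iter n (Nd Lf) Lf.
#[global] Instance enc_seq (T : Type) (H : Enc T) : Enc (seq T) :=
  foldr (fun x t => Nd (enc x) t) Lf.
Arguments enc_seq : simpl never.
#[global] Instance enc_prod (T U : Type) (H : Enc T) (H' : Enc U) : Enc (T * U) :=
  fun p => Nd (enc p.1) (enc p.2).

Definition esize (T : Type) (H : Enc T) (x : T) := size (code (enc x)).
Arguments esize {T H} x.

Lemma code_cons T (H : Enc T) (x : T) s :
  code (enc (x :: s)) = true :: code (enc x) ++ code (enc s).
Proof. by []. Qed.

Lemma esize_pair T U (H : Enc T) (H' : Enc U) (x : T) (y : U) :
  esize (x, y) = (esize x + esize y).+1.
Proof. by rewrite /esize /= size_cat. Qed.

Lemma esize_cons T (H : Enc T) (x : T) s : esize (x :: s) = (esize x + esize s).+1.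
Proof. by rewrite /esize code_cons /= size_cat. Qed.

Lemma esize_nat (n : nat) : esize n = n.*2.+1.
Proof. by elim: n => // n IH; move: IH; rewrite /esize /= => ->. Qed.

Lemma esize_bool (b : bool) : esize b <= 3.
Proof. by case: b. Qed.

Lemma esize_bits (s : seq bool) : esize s <= 4 * size s + 1.
Proof. by elim: s => // x s IH; rewrite esize_cons /=; have := esize_bool x; lia. Qed.

Lemma size_le_esize T (H : Enc T) (s : seq T) : size s <= esize s.
Proof. by elim: s => // x s IH; rewrite esize_cons /=; lia. Qed.

(** The arbitrary [rest] lets a computation run on top of stored values; the size bound on [f x] is
    what makes composition possible. *)
Definition ptime (A B : Type) (HA : Enc A) (HB : Enc B) (f : A -> B) :=
  exists (F : flow unit) k, forall x,
    esize (f x) <= bnd k (esize x) /\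
    forall rest, sev F (main (code (enc x) ++ rest)) (bnd k (esize x + size rest)) tt
                  (main (code (enc (f x)) ++ rest)).
Arguments ptime {A B HA HB} f.

Lemma ptime_intro A B (HA : Enc A) (HB : Enc B) (f : A -> B) F p q :
  polyb p -> polyb q ->
  (forall x, esize (f x) <= p (esize x)) ->
  (forall x rest, sev F (main (code (enc x) ++ rest)) (q (esize x + size rest)) tt
                  (main (code (enc (f x)) ++ rest))) ->
  ptime f.
Proof.
move=> [a ha] [b hb] h1 h2; exists F, (a + b) => x; split.
  by apply: leq_trans (h1 x) _; apply: leq_trans (ha _) _; rewrite bnd_monok ?leq_addr.
move=> rest; apply: sev_le (h2 x rest) _.
by apply: leq_trans (hb _) _; rewrite bnd_monok ?leq_addl.
Qed.

Lemma ptime_ext A B (HA : Enc A) (HB : Enc B) (f g : A -> B) :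
  ptime f -> f =1 g -> ptime g.
Proof. by move=> [F [k h]] e; exists F, k => x; rewrite -e. Qed.

Lemma ptime_coerce A B (HA : Enc A) (HB : Enc B) (f : A -> B) :
  (forall x, enc (f x) = enc x) -> ptime f.
Proof.
move=> e; apply: (ptime_intro (F := ret tt) polyb_id (polyb_const 1)).
  by move=> x; rewrite /esize e.
by move=> x rest; rewrite e; apply: sev_ret.
Qed.

Lemma ptime_id A (HA : Enc A) : ptime (fun x : A => x).
Proof. exact: ptime_coerce. Qed.

Lemma ptime_comp A B C (HA : Enc A) (HB : Enc B) (HC : Enc C) (g : B -> C) (f : A -> B) :
  ptime g -> ptime f -> ptime (fun x => g (f x)).
Proof.
move=> [G [kg hg]] [F [kf hf]].
apply: (ptime_intro (F := seqf F G) (p := fun n => bnd kg (bnd kf n))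
   (q := fun n => bnd kf n + bnd kg (bnd kf n + n))); [polyb|polyb| |].
  move=> x; have [a _] := hf x; have [b _] := hg (f x).
  exact: leq_trans b (bnd_mono _ a).
move=> x rest; have [a h1] := hf x; have [b h2] := hg (f x).
apply: sev_seqf (h1 rest) _; apply: sev_le (h2 rest) _; apply: bnd_mono.
apply: leq_add; last by rewrite leq_addl.
by apply: leq_trans a _; rewrite bnd_mono ?leq_addr.
Qed.

Fixpoint pushes (w : seq bool) : flow unit :=
  if w is b :: w' then seqf (pushes w') (push tA b) else ret tt.

Lemma sev_pushes w X :
  sev (pushes w) (main X) ((2 * (size w + size X) + 3) * (size w).+1) tt (main (w ++ X)).
Proof.
elim: w => [|b w IH]; first by apply: (sev_le (sev_ret _ _)); lia.
rewrite /=; apply: (@sev_le _ _ _ ((2 * (size w + size X) + 3) * (size w).+1 + (2 * (size w + size X) + 3))); last nia.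
apply: sev_seqf IH _; apply: sev_push_le; rewrite ?mkE ?updE //.
by rewrite size_cat.
Qed.

Lemma ptime_const A B (HA : Enc A) (HB : Enc B) (c : B) : ptime (fun _ : A => c).
Proof.
set w := code (enc c).
apply: (ptime_intro (F := seqf drop_top (pushes w)) (p := fun _ => size w)
  (q := fun n => op_cost n + (2 * (size w + n) + 3) * (size w).+1)); [polyb|polyb|by []|].
move=> x rest; apply: sev_seqf; first exact: sev_drop.
by apply: sev_le (sev_pushes _ _) _; rewrite leq_mul2r; apply/orP; right; lia.
Qed.

Lemma ptime_pair A B C (HA : Enc A) (HB : Enc B) (HC : Enc C) (f : A -> B) (g : A -> C) :
  ptime f -> ptime g -> ptime (fun x => (f x, g x)).
Proof.
move=> [F [kf hf]] [G [kg hg]].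
apply: (ptime_intro
  (F := seqf dup (seqf G (seqf swap (seqf F (push tA true)))))
  (p := fun n => (bnd kf n + bnd kg n).+1)
  (q := fun n => op_cost n + (bnd kg (n + n) + (op_cost (bnd kg n + n) + (bnd kf (n + bnd kg n) +
       (2 * (bnd kf n + bnd kg n + n) + 3)))))); [polyb|polyb| |].
  by move=> x; rewrite esize_pair ltnS leq_add ?(proj1 (hf x)) ?(proj1 (hg x)).
move=> x rest; have [a h1] := hf x; have [b h2] := hg x.
have c1 : bnd kg (esize x) <= bnd kg (esize x + size rest) by rewrite bnd_mono ?leq_addr.
have c2 : bnd kf (esize x) <= bnd kf (esize x + size rest) by rewrite bnd_mono ?leq_addr.
apply: sev_seqf; first exact: sev_dup.
apply: sev_seqf.
  apply: sev_le (h2 _) _; apply: bnd_mono; rewrite size_cat -/(esize x); lia.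
apply: sev_seqf.
  apply: sev_le; first exact: sev_swap.
  rewrite /op_cost -/(esize x) -/(esize (g x)).
  rewrite leq_mul2l leq_mul //; lia.
apply: sev_seqf.
  apply: sev_le (h1 _) _; apply: bnd_mono; rewrite size_cat -/(esize (g x)); lia.
apply: sev_push_le; rewrite ?mkE ?updE /=; last by rewrite catA.
rewrite !size_cat -/(esize (g x)) -/(esize (f x)); lia.
Qed.

Lemma ptime_fst A B C (HA : Enc A) (HB : Enc B) (HC : Enc C) (f : A -> B * C) :
  ptime f -> ptime (fun x => (f x).1).
Proof.
apply: ptime_comp => {f A HA}.
apply: (ptime_intro (F := bind (pop tA) (fun _ => seqf swap drop_top))
  (p := fun n => n) (q := fun n => (2 * n + 3) + (op_cost n + op_cost n))); [polyb|polyb| |].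
  by move=> -[x y]; rewrite esize_pair /=; lia.
move=> [x y] rest; rewrite esize_pair /=.
apply: sev_bind; first by apply: sev_pop_le; rewrite ?mkE ?updE //= !size_cat -/(esize x) -/(esize y); lia.
rewrite ?mkE ?updE /= -catA; apply: sev_seqf; apply: sev_le.
- exact: sev_swap.
- by rewrite leq_mul2l leq_mul //= -/(esize x) -/(esize y); lia.
- exact: sev_drop.
- by rewrite leq_mul2l leq_mul //= size_cat -/(esize x) -/(esize y); lia.
Qed.

Lemma ptime_snd A B C (HA : Enc A) (HB : Enc B) (HC : Enc C) (f : A -> B * C) :
  ptime f -> ptime (fun x => (f x).2).
Proof.
apply: ptime_comp => {f A HA}.
apply: (ptime_intro (F := bind (pop tA) (fun _ => drop_top))
  (p := fun n => n) (q := fun n => (2 * n + 3) + op_cost n)); [polyb|polyb| |].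
  by move=> -[x y]; rewrite esize_pair /=; lia.
move=> [x y] rest; rewrite esize_pair /=.
apply: sev_bind; first by apply: sev_pop_le; rewrite ?mkE ?updE //= !size_cat -/(esize x) -/(esize y); lia.
rewrite ?mkE ?updE /= -catA; apply: sev_le; first exact: sev_drop.
by rewrite leq_mul2l leq_mul //= size_cat -/(esize x) -/(esize y); lia.
Qed.

Lemma ptime_cons A T (HA : Enc A) (HT : Enc T) (f : A -> T) (g : A -> seq T) :
  ptime f -> ptime g -> ptime (fun x => f x :: g x).
Proof.
move=> hf hg.
apply: (ptime_comp (f := fun x => (f x, g x)) (g := fun p => p.1 :: p.2)); last exact: ptime_pair.
exact: ptime_coerce.
Qed.

Lemma ptime_succ A (HA : Enc A) (f : A -> nat) : ptime f -> ptime (fun x => (f x).+1).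
Proof.
move=> hf; apply: (ptime_comp (f := fun x => (tt, f x)) (g := fun p : unit * nat => p.2.+1)).
  by apply: ptime_coerce => -[[] n].
by apply: ptime_pair => //; exact: ptime_const.
Qed.

Lemma ptime_if A B (HA : Enc A) (HB : Enc B) (b : A -> bool) (f g : A -> B) :
  ptime b -> ptime f -> ptime g -> ptime (fun x => if b x then f x else g x).
Proof.
move=> [T [kt ht]] [F [kf hf]] [G [kg hg]].
apply: (ptime_intro (p := fun n => bnd kf n + bnd kg n)
  (F := seqf dup (seqf T (bind (pop tA) (fun o : option bool =>
     if o is Some true then bind (pop tA) (fun _ => bind (pop tA) (fun _ => F)) else G))))
  (q := fun n => op_cost n + (bnd kt (n + n) + ((2 * (n + 3) + 3) +
      ((2 * (n + 3) + 3) + ((2 * (n + 3) + 3) + (bnd kf n + bnd kg n))))))); [polyb|polyb| |].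
  move=> x; have [a _] := hf x; have [c _] := hg x.
  by case: (b x); lia.
move=> x rest; have [a h1] := hf x; have [c h2] := hg x; have [d h3] := ht x.
apply: sev_seqf; first exact: sev_dup.
apply: sev_seqf.
  by apply: sev_le (h3 _) _; apply: bnd_mono; rewrite size_cat -/(esize x); lia.
case: (b x) => /=.
  (* The code of [true] has three symbols, that of [false] only one. *)
  do 3!(apply: sev_bind; first by apply: sev_pop_le;
    rewrite ?mkE ?updE //= size_cat -/(esize x) //; lia).
  by rewrite ?mkE ?updE /=; apply: sev_le (h1 _) _; rewrite leq_addr.
apply: (sev_bind (e := Some false) (s1 := main (code (enc x) ++ rest))).
  by apply: sev_pop_le; rewrite ?mkE ?updE //= size_cat -/(esize x) //; lia.
by apply: sev_le (h2 _) _; lia.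
Qed.

Lemma ptime_nilp A T (HA : Enc A) (HT : Enc T) (f : A -> seq T) :
  ptime f -> ptime (fun x => nilp (f x)).
Proof.
apply: ptime_comp => {f A HA}.
apply: (ptime_intro (p := fun _ => 3)
  (F := bind (pop tA) (fun o : option bool =>
     if o is Some true then seqf (push tA true) (seqf drop_top (push tA false))
     else seqf (push tA false) (seqf (push tA false) (push tA true))))
  (q := fun n => (2 * n + 3) + ((2 * n + 3) + ((op_cost n + (2 * n + 3)) + (2 * (n + 2) + 3))))); [polyb|polyb| |].
  by move=> [].
move=> s rest.
case: s => [|y s]; rewrite ?esize_cons ?code_cons /=.
  apply: sev_bind; first by apply: sev_pop_le; rewrite ?mkE ?updE //=.
  rewrite ?mkE ?updE /=.
  apply: sev_seqf; first by apply: sev_push_le; rewrite ?mkE ?updE //=; lia.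
  apply: (@sev_le _ _ _ ((2 * (size rest).+1 + 3) + (2 * (size rest).+2 + 3))).
    apply: sev_seqf; first by apply: sev_push_le; rewrite ?mkE ?updE //=; lia.
    by apply: sev_push_le; rewrite ?mkE ?updE //=; lia.
  by rewrite /esize /=; lia.
apply: sev_bind.
  by apply: sev_pop_le; rewrite ?mkE ?updE //= !size_cat -/(esize y) -/(esize s); lia.
rewrite ?mkE ?updE /=.
apply: sev_seqf.
  by apply: sev_push_le; rewrite ?mkE ?updE //= !size_cat -/(esize y) -/(esize s); lia.
rewrite ?updE ?mkE.
apply: (@sev_le _ _ _ (op_cost (esize (y :: s) + size rest) + (2 * size rest + 3))).
  apply: sev_seqf; first exact: (@sev_drop (enc (y :: s))).
  by apply: sev_push_le; rewrite ?mkE ?updE.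
rewrite esize_cons; lia.
Qed.

Lemma ptime_behead A T (HA : Enc A) (HT : Enc T) (f : A -> seq T) :
  ptime f -> ptime (fun x => behead (f x)).
Proof.
apply: ptime_comp => {f A HA}.
apply: (ptime_intro (p := fun n => n)
  (F := bind (pop tA) (fun o : option bool =>
     if o is Some true then drop_top else push tA false))
  (q := fun n => (2 * n + 3) + (op_cost n + (2 * n + 3)))); [polyb|polyb| |].
  by move=> [|y s] //=; rewrite esize_cons; lia.
move=> [|y s] rest; rewrite ?esize_cons ?code_cons /=.
  apply: sev_bind; first by apply: sev_pop_le; rewrite ?mkE ?updE //=.
  rewrite ?mkE ?updE /=.
  apply: sev_le; first by apply: sev_push_le; rewrite ?mkE ?updE.
  by rewrite /esize /=; lia.
apply: sev_bind.
  by apply: sev_pop_le; rewrite ?mkE ?updE //= !size_cat -/(esize y) -/(esize s); lia.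
rewrite ?mkE ?updE /= -catA.
apply: sev_le; first exact: sev_drop.
rewrite size_cat -/(esize y) -/(esize s).
apply: leq_trans (leq_addr _ _); rewrite leq_mul2l leq_mul //; lia.
Qed.

Lemma ptime_head A T (HA : Enc A) (HT : Enc T) (c : T) (f : A -> seq T) :
  ptime f -> ptime (fun x => head c (f x)).
Proof.
move=> hf.
apply: (ptime_ext (f := fun x => if nilp (f x) then c else head c (f x))); last by move=> x; case: (f x).
apply: (ptime_comp (g := fun s => if nilp s then c else head c s)) hf => {f A HA}.
(* A nonempty list is read as the pair of its head and tail, so the first projection yields the
   head. *)
have [G [k hG]] : ptime (fun p : T * seq T => p.1) by apply: ptime_fst; exact: ptime_id.
have [C [k' hC]] := @ptime_const (seq T) _ _ _ c.
apply: (ptime_intro (p := fun n => bnd k n + bnd k' n)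
  (F := bind (pop tA) (fun o : option bool =>
     if o is Some true then seqf (push tA true) G else seqf (push tA false) C))
  (q := fun n => (2 * n + 3) + ((2 * n + 3) + (bnd k n + bnd k' n)))); [polyb|polyb| |].
  move=> [|y s] /=.
    by have [h _] := hC [::]; lia.
  by have [h _] := hG (y, s); rewrite esize_pair -esize_cons /= in h; lia.
move=> [|y s] rest; rewrite ?code_cons /=.
  apply: sev_bind; first by apply: sev_pop_le; rewrite ?mkE ?updE //=.
  rewrite ?mkE ?updE /=.
  apply: sev_seqf; first by apply: sev_push_le; rewrite ?mkE ?updE //= /esize /=; lia.
  have [_ h] := hC [::].
  by apply: sev_le (h _) _; rewrite leq_addl.
apply: sev_bind.
  by apply: sev_pop_le; rewrite ?mkE ?updE //= !size_cat /esize ?code_cons /= !size_cat; lia.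
rewrite ?mkE ?updE /=.
apply: sev_seqf.
  by apply: sev_push_le; rewrite ?mkE ?updE //= !size_cat /esize ?code_cons /= !size_cat; lia.
rewrite ?updE ?mkE.
have [_ h] := hG (y, s).
by apply: sev_le (h _) _; rewrite esize_pair esize_cons leq_addr.
Qed.

(** * Iteration along a list *)

Section Fold.
Variables (E S T : Type) (HE : Enc E) (HS : Enc S) (HT : Enc T).
Variables (f : E -> S -> T -> S).

Let body (p : (T * seq T) * (E * S)) := (p.1.2, (p.2.1, f p.2.1 p.2.2 p.1.1)).

(** The two pops remove the tags of the outer pair and of the list in [(l, (e, acc))]. For a
    nonempty list, putting them back gives the code of [((x, l'), (e, acc))], the argument of
    [body]; for an empty one the code of [(e, acc)] is left. *)
Definition fold_body (G : flow unit) (_ : unit) : flow (unit + unit) :=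
  bind (pop tA) (fun _ => bind (pop tA) (fun o : option bool =>
    if o is Some true then
      seqf (push tA true) (seqf (push tA true) (seqf G (ret (inl tt))))
    else ret (inr tt))).

Definition fold_cost k M := 4 * (2 * M + 3) + bnd k M + 1.

Lemma sev_fold G kg :
  (forall x rest, sev G (main (code (enc x) ++ rest)) (bnd kg (esize x + size rest)) tt
                  (main (code (enc (body x)) ++ rest))) ->
  forall e rest M l acc,
  (forall i, esize l + esize e + esize (foldl (f e) acc (take i l)) + 3 + size rest <= M) ->
  sev (loop (fold_body G) tt) (main (code (enc (l, (e, acc))) ++ rest))
    ((size l).+1 * fold_cost kg M) tt (main (code (enc (e, foldl (f e) acc l)) ++ rest)).
Proof.
move=> hG e rest M; elim=> [|x l IH] acc hM.
  rewrite mul1n; apply: sev_loop_exit.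
  have := hM 0; rewrite /= {1}/esize /= => h0.
  apply: (@sev_le _ _ _ ((2 * M + 3) + ((2 * M + 3) + 1))); last by rewrite /fold_cost; lia.
  apply: sev_bind; first by apply: sev_pop_le; rewrite ?mkE ?updE //= !size_cat
    -/(esize e) -/(esize acc); lia.
  rewrite ?mkE ?updE /=.
  apply: sev_bind; first by apply: sev_pop_le; rewrite ?mkE ?updE //= !size_cat
    -/(esize e) -/(esize acc); lia.
  rewrite ?mkE ?updE /=.
  exact: sev_ret.
have es : code (enc (x :: l, (e, acc))) = true :: true :: (code (enc x) ++ code (enc l)) ++ code (enc (e, acc)).
  by [].
rewrite es [foldl _ _ _]/= [size _]/= mulSn; apply: sev_loop_next; last first.
  apply: IH => i; have := hM i.+1; rewrite /= esize_cons; lia.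
have := hM 0; rewrite /= esize_cons => h0.
have ea : size (code (enc (e, acc))) = (esize e + esize acc).+1 by rewrite -esize_pair.
apply: (@sev_le _ _ _ ((2 * M + 3) + ((2 * M + 3) + ((2 * M + 3) + ((2 * M + 3) + (bnd kg M + 1)))))); last by rewrite /fold_cost; lia.
apply: sev_bind; first by apply: sev_pop_le; rewrite ?mkE ?updE //= !size_cat
    ea -/(esize x) -/(esize l); lia.
rewrite ?mkE ?updE.
apply: sev_bind; first by apply: sev_pop_le; rewrite ?mkE ?updE //= !size_cat
    ea -/(esize x) -/(esize l); lia.
rewrite ?mkE ?updE.
apply: sev_seqf; first by apply: sev_push_le; rewrite ?mkE ?updE //= !size_cat
    ea -/(esize x) -/(esize l); lia.
rewrite ?mkE ?updE.
apply: sev_seqf; first by apply: sev_push_le; rewrite ?mkE ?updE //= !size_cat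
    ea -/(esize x) -/(esize l); lia.
rewrite ?mkE ?updE.
apply: sev_seqf; last exact: sev_ret.
apply: sev_le (hG ((x, l), (e, acc)) rest) _; apply: bnd_mono.
rewrite !esize_pair; lia.
Qed.

(** Without a bound on all partial folds, a step that squares the size would leave every
    polynomial. *)
Lemma ptime_foldl (s : E -> seq T) (z : E -> S) k :
  ptime (fun p : E * S * T => f p.1.1 p.1.2 p.2) -> ptime s -> ptime z ->
  (forall e i, esize (foldl (f e) (z e) (take i (s e))) <= bnd k (esize e)) ->
  ptime (fun e => foldl (f e) (z e) (s e)).
Proof.
move=> hf hs hz hk.
have [P [kp hP]] : ptime (fun e => (s e, (e, z e))).
  by apply: ptime_pair => //; apply: ptime_pair => //; exact: ptime_id.
have [G [kg hG]] : ptime body.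
  apply: ptime_pair; first by apply: ptime_snd; apply: ptime_fst; exact: ptime_id.
  apply: ptime_pair; first by apply: ptime_fst; apply: ptime_snd; exact: ptime_id.
  apply: (ptime_comp hf (f := fun p : (T * seq T) * (E * S) => (p.2.1, p.2.2, p.1.1))).
  apply: ptime_pair; first by apply: ptime_pair; [apply: ptime_fst|apply: ptime_snd]; apply: ptime_snd; exact: ptime_id.
  by do 2!apply: ptime_fst; exact: ptime_id.
have [D [kd hD]] : ptime (fun p : E * S => p.2) by apply: ptime_snd; exact: ptime_id.
have [Fs [ks hs']] := hs.
pose M n := bnd ks n + n + bnd k n + 3.
apply: (ptime_intro (F := seqf P (seqf (loop (fold_body G) tt) D)) (p := bnd k)
  (q := fun n => bnd kp n + ((bnd ks n).+1 * fold_cost kg (M n) + bnd kd (M n)))).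
- by apply: polyb_bnd; exact: polyb_id.
- by rewrite /fold_cost /M; polyb.
- by move=> e; rewrite -{1}(take_size (s e)).
move=> e rest; move en : (esize e + size rest) => n.
have [_ h1] := hP e.
have hle : esize e <= n by rewrite -en leq_addr.
have hsz : esize (s e) <= bnd ks n.
  by have [h _] := hs' e; apply: leq_trans h _; rewrite bnd_mono.
have hb i : esize (foldl (f e) (z e) (take i (s e))) <= bnd k n.
  by apply: leq_trans (hk e i) _; rewrite bnd_mono.
apply: sev_seqf; first by rewrite -en; apply: sev_le (h1 rest) _.
apply: sev_seqf.
  apply: sev_le; first apply: (sev_fold (M := M n) (fun x => proj2 (hG x))).
    by move=> i; have := hb i; rewrite /M; lia.
  by apply: leq_mul => //; have := @size_le_esize _ HT (s e); lia.
have [_ h] := hD (e, foldl (f e) (z e) (s e)).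
apply: sev_le (h rest) _; apply: bnd_mono; rewrite esize_pair.
have := hb (size (s e)); rewrite take_size /M; lia.
Qed.

(* Sizes stay polynomial because the measure [mu] grows additively along the fold. *)
Lemma ptime_foldl_mu (s : E -> seq T) (z : E -> S)
    (I : E -> S -> Prop) (mu : E -> S -> nat) k :
  ptime (fun p : E * S * T => f p.1.1 p.1.2 p.2) -> ptime s -> ptime z ->
  (forall e, I e (z e) /\ mu e (z e) <= bnd k (esize e)) ->
  (forall e a x, I e a -> esize x <= esize (s e) ->
     I e (f e a x) /\ mu e (f e a x) <= mu e a + bnd k (esize e)) ->
  (forall e a, I e a -> esize a <= bnd k (esize e + mu e a)) ->
  ptime (fun e => foldl (f e) (z e) (s e)).
Proof.
move=> hf hs hz h1 h2 h3.
have [Fs [ks hs']] := hs.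
(* [bnd k n] bounds the initial measure and each increment, [bnd ks n] the number of steps. *)
have [K hK] : polyb (fun n => bnd k (n + (bnd ks n).+1 * bnd k n)) by polyb.
apply: (ptime_foldl (k := K)) => // e i; apply: leq_trans (hK _).
have hx l : (forall j, esize (take j l) <= esize (s e)) -> size l <= size (s e) -> forall a, I e a ->
    I e (foldl (f e) a l) /\ mu e (foldl (f e) a l) <= mu e a + size l * bnd k (esize e).
- elim: l => [|x l IH] hl hsz a ha; first by rewrite /=; split=> //; lia.
  have hx : esize x <= esize (s e).
    by have := hl 1; rewrite /= take0 esize_cons; lia.
  have [b1 b2] := h2 e a x ha hx.
  have [|||c1 c2] := IH _ _ (f e a x) => //.
  + by move=> j; have := hl j.+1; rewrite /= esize_cons; lia.
  + by rewrite ltnW.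
  by split=> //=; rewrite mulSn; lia.
have tk (l : seq T) j : esize (take j l) <= esize l.
  elim: l j => [|x l IH] [|j] //.
  rewrite -[take j.+1 (x :: l)]/(x :: take j l) !esize_cons; have := IH j; lia.
have [b1 b2] := h1 e.
have [||c1 c2] := hx (take i (s e)) _ _ (z e) b1.
- by move=> j; apply: leq_trans (tk _ _) (tk _ _).
- by rewrite size_take_min geq_minr.
apply: leq_trans (h3 _ _ c1) _; apply: bnd_mono; rewrite leq_add2l.
apply: leq_trans c2 _; rewrite mulSn leq_add // leq_mul2r; apply/orP; right.
have [h _] := hs' e; apply: leq_trans h; apply: leq_trans (@size_le_esize _ _ _).
by rewrite size_take_min geq_minr.
Qed.

End Fold.

Lemma ptime_units A (HA : Enc A) (n : A -> nat) : ptime n -> ptime (fun x => nseq (n x) tt).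
Proof.
move=> hn; apply: (ptime_comp (g := fun m => nseq m tt)) hn.
by apply: ptime_coerce; elim=> // m; rewrite /enc /= => <-.
Qed.

Lemma ptime_iter_mu E S (HE : Enc E) (HS : Enc S) (f : E -> S -> S) (n : E -> nat) (z : E -> S)
    (I : E -> S -> Prop) (mu : E -> S -> nat) k :
  ptime (fun p : E * S => f p.1 p.2) -> ptime n -> ptime z ->
  (forall e, I e (z e) /\ mu e (z e) <= bnd k (esize e)) ->
  (forall e a, I e a -> I e (f e a) /\ mu e (f e a) <= mu e a + bnd k (esize e)) ->
  (forall e a, I e a -> esize a <= bnd k (esize e + mu e a)) ->
  ptime (fun e => iter (n e) (f e) (z e)).
Proof.
move=> hf hn hz h1 h2 h3.
apply: (ptime_ext (f := fun e => foldl (fun a (_ : unit) => f e a) (z e) (nseq (n e) tt))).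
  apply: (ptime_foldl_mu (f := fun e a (_ : unit) => f e a) (I := I) (mu := mu) (k := k)) => //.
  - by apply: (ptime_comp hf (f := fun p : E * S * unit => p.1)); apply: ptime_fst; exact: ptime_id.
  - exact: ptime_units.
  - by move=> e a x ha _; exact: h2.
move=> e; elim: (n e) (z e) => // m IH a.
by rewrite iterSr /= IH.
Qed.

Lemma ptime_comp2 A B C D (HA : Enc A) (HB : Enc B) (HC : Enc C) (HD : Enc D)
    (h : B -> C -> D) (f : A -> B) (g : A -> C) :
  ptime (fun p : B * C => h p.1 p.2) -> ptime f -> ptime g -> ptime (fun x => h (f x) (g x)).
Proof.
by move=> hh hf hg; apply: (ptime_comp hh (f := fun x => (f x, g x))); apply: ptime_pair.
Qed.

Lemma bnd_gt0 k n : 0 < bnd k n.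
Proof. by rewrite /bnd expn_gt0. Qed.

(** The constants come from [2 ^ 9 * (n + 2)], which [(n + 2) ^ 10] dominates; a linear bound
    generous enough for the routine size estimates that follow. *)
Lemma bnd10 n : 512 * n + 1024 <= bnd 10 n.
Proof.
have h : 2 ^ 9 <= n.+2 ^ 9 by rewrite leq_exp2r.
rewrite /bnd expnS; apply: (@leq_trans (n.+2 * 2 ^ 9)); last by apply: leq_mul.
by rewrite (_ : 2 ^ 9 = 512) //; lia.
Qed.

#[local] Opaque bnd.

Lemma bnd10_le a n : a <= 512 * n + 1024 -> a <= bnd 10 n.
Proof. by move=> h; apply: leq_trans h (bnd10 n). Qed.

(** * Boolean operations, unary arithmetic and lists *)

Section Pointwise.
Variables (A : Type) (HA : Enc A).

Lemma ptime_negb (f : A -> bool) : ptime f -> ptime (fun x => ~~ f x).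
Proof.
move=> h; apply: (ptime_ext (f := fun x => if f x then false else true)).
  by apply: ptime_if => //; exact: ptime_const.
by move=> x; case: (f x).
Qed.

Lemma ptime_andb (f g : A -> bool) : ptime f -> ptime g -> ptime (fun x => f x && g x).
Proof.
move=> hf hg; apply: (ptime_ext (f := fun x => if f x then g x else false)).
  by apply: ptime_if => //; exact: ptime_const.
by move=> x; case: (f x).
Qed.

Lemma ptime_orb (f g : A -> bool) : ptime f -> ptime g -> ptime (fun x => f x || g x).
Proof.
move=> hf hg; apply: (ptime_ext (f := fun x => if f x then true else g x)).
  by apply: ptime_if => //; exact: ptime_const.
by move=> x; case: (f x).
Qed.

Lemma ptime_addb (f g : A -> bool) : ptime f -> ptime g -> ptime (fun x => f x (+) g x).
Proof.
move=> hf hg; apply: (ptime_ext (f := fun x => if f x then ~~ g x else g x)).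
  by apply: ptime_if => //; apply: ptime_negb.
by move=> x; case: (f x).
Qed.

Lemma ptime_eqb (f g : A -> bool) : ptime f -> ptime g -> ptime (fun x => f x == g x).
Proof.
move=> hf hg; apply: (ptime_ext (f := fun x => ~~ (f x (+) g x))).
  by apply: ptime_negb; apply: ptime_addb.
by move=> x; case: (f x); case: (g x).
Qed.

End Pointwise.

Ltac pt1 := fail.
Ltac pt := repeat (cbv beta; lazymatch goal with
  | |- ptime (fun x => x) => exact: ptime_id
  | |- ptime id => exact: ptime_id
  | |- ptime fst => exact: ptime_fst (ptime_id _)
  | |- ptime snd => exact: ptime_snd (ptime_id _)
  | |- ptime (fun _ => fst _) => apply: ptime_fst
  | |- ptime (fun _ => snd _) => apply: ptime_snd
  | |- ptime (fun _ => (_, _)) => first [exact: ptime_const | apply: ptime_pair]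
  | |- ptime (fun _ => _ :: _) => first [exact: ptime_const | apply: ptime_cons]
  | |- ptime (fun _ => _.+1) => first [exact: ptime_const | apply: ptime_succ]
  | |- ptime (fun _ => behead _) => apply: ptime_behead
  | |- ptime (fun _ => nilp _) => apply: ptime_nilp
  | |- ptime (fun _ => head _ _) => apply: ptime_head
  | |- ptime (fun _ => ~~ _) => apply: ptime_negb
  | |- ptime (fun _ => _ && _) => apply: ptime_andb
  | |- ptime (fun _ => _ || _) => apply: ptime_orb
  | |- ptime (fun _ => _ (+) _) => apply: ptime_addb
  | |- ptime (fun _ => _ == _) => apply: ptime_eqb
  | |- ptime (fun _ => nseq _ tt) => apply: ptime_units
  | |- ptime (fun _ => if _ then _ else _) => apply: ptime_if
  | |- ptime _ => first [assumption | exact: ptime_const | pt1]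
  end).

Lemma ptime_size A T (HA : Enc A) (HT : Enc T) (s : A -> seq T) :
  ptime s -> ptime (fun x => size (s x)).
Proof.
apply: (ptime_comp (g := size)).
apply: (ptime_ext (f := fun s : seq T => foldl (fun n _ => n.+1) 0 s)).
  apply: (ptime_foldl_mu (f := fun _ n _ => n.+1) (I := fun _ _ => True)
     (mu := fun _ n => esize n) (k := 10)).
  - by pt.
  - by pt.
  - by pt.
  - by move=> e; split=> //; apply: bnd10_le; rewrite esize_nat; lia.
  - move=> e a x _ _; split=> //; rewrite !esize_nat; pose proof (bnd10 (esize e)); lia.
  - by move=> e a _; apply: bnd10_le; lia.
move=> s'; rewrite -[RHS]addn0; elim: s' 0 => //= x s' IH n.
by rewrite IH addSnnS.
Qed.

Lemma ptime_addn A (HA : Enc A) (f g : A -> nat) :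
  ptime f -> ptime g -> ptime (fun x => f x + g x).
Proof.
apply: ptime_comp2.
apply: (ptime_ext (f := fun p : nat * nat => iter p.1 succn p.2)).
  apply: (ptime_iter_mu (f := fun _ => succn) (I := fun _ _ => True)
     (mu := fun _ n => esize n) (k := 10)).
  - by pt.
  - by pt.
  - by pt.
  - by move=> [x y]; split=> //; apply: bnd10_le; rewrite esize_pair /=; lia.
  - move=> e a _; split=> //; rewrite !esize_nat; pose proof (bnd10 (esize e)); lia.
  - by move=> e a _; apply: bnd10_le; lia.
by move=> [x y] /=; elim: x => //= x ->.
Qed.

Lemma ptime_pred A (HA : Enc A) (f : A -> nat) : ptime f -> ptime (fun x => (f x).-1).
Proof.
move=> h; apply: (ptime_ext (f := fun x => size (behead (nseq (f x) tt)))).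
  by apply: ptime_size; pt.
by move=> x; rewrite size_behead size_nseq.
Qed.

Lemma ptime_subn A (HA : Enc A) (f g : A -> nat) :
  ptime f -> ptime g -> ptime (fun x => f x - g x).
Proof.
apply: ptime_comp2.
apply: (ptime_ext (f := fun p : nat * nat => iter p.2 predn p.1)).
  apply: (ptime_iter_mu (f := fun _ => predn) (I := fun _ _ => True)
     (mu := fun _ n => esize n) (k := 10)).
  - by apply: ptime_pred; pt.
  - by pt.
  - by pt.
  - by move=> [x y]; split=> //; apply: bnd10_le; rewrite esize_pair /=; lia.
  - move=> e a _; split=> //; rewrite !esize_nat; pose proof (bnd10 (esize e)); lia.
  - by move=> e a _; apply: bnd10_le; lia.
by move=> [x y] /=; elim: y => //= [|y ->]; lia.
Qed.

Lemma ptime_leq A (HA : Enc A) (f g : A -> nat) :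
  ptime f -> ptime g -> ptime (fun x => f x <= g x).
Proof.
move=> hf hg; apply: (ptime_ext (f := fun x => nilp (nseq (f x - g x) tt))).
  by pt; apply: ptime_subn.
by move=> x; rewrite /nilp size_nseq.
Qed.

Lemma ptime_maxn A (HA : Enc A) (f g : A -> nat) :
  ptime f -> ptime g -> ptime (fun x => maxn (f x) (g x)).
Proof.
move=> hf hg; apply: (ptime_ext (f := fun x => f x + (g x - f x))).
  by apply: ptime_addn => //; apply: ptime_subn.
by move=> x; rewrite maxnE.
Qed.

Lemma ptime_drop A T (HA : Enc A) (HT : Enc T) (n : A -> nat) (s : A -> seq T) :
  ptime n -> ptime s -> ptime (fun x => drop (n x) (s x)).
Proof.
apply: ptime_comp2.
apply: (ptime_ext (f := fun p : nat * seq T => iter p.1 behead p.2)).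
  apply: (ptime_iter_mu (f := fun _ => behead) (I := fun _ _ => True)
     (mu := fun _ n => esize n) (k := 10)).
  - by pt.
  - by pt.
  - by pt.
  - by move=> [x y]; split=> //; apply: bnd10_le; rewrite esize_pair /=; lia.
  - by move=> e a _; split=> //; case: a => [|x a] //=; rewrite ?esize_cons; lia.
  - by move=> e a _; apply: bnd10_le; lia.
move=> [x y] /=; elim: x y => [|x IH] y; first by rewrite drop0.
by rewrite iterSr IH; case: y.
Qed.

Lemma ptime_catrev A T (HA : Enc A) (HT : Enc T) (s t : A -> seq T) :
  ptime s -> ptime t -> ptime (fun x => catrev (s x) (t x)).
Proof.
apply: ptime_comp2.
apply: (ptime_ext (f := fun p : seq T * seq T => foldl (fun a x => x :: a) p.2 p.1)).
  apply: (ptime_foldl_mu (f := fun _ a x => x :: a) (I := fun _ _ => True)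
     (mu := fun _ n => esize n) (k := 10)).
  - by pt.
  - by pt.
  - by pt.
  - by move=> [x y]; split=> //; apply: bnd10_le; rewrite esize_pair /=; lia.
  - move=> [p q] a x _ /=; split=> //; rewrite !esize_cons !esize_pair.
    pose proof (bnd10 (esize p + esize q).+1); lia.
  - by move=> e a _; apply: bnd10_le; lia.
by move=> [x y] /=; elim: x y => //= a x IH y; rewrite IH.
Qed.

Lemma ptime_rev A T (HA : Enc A) (HT : Enc T) (s : A -> seq T) :
  ptime s -> ptime (fun x => rev (s x)).
Proof. by move=> h; apply: ptime_catrev => //; exact: ptime_const. Qed.

Lemma ptime_nseq A T (HA : Enc A) (HT : Enc T) (c : T) (n : A -> nat) :
  ptime n -> ptime (fun x => nseq (n x) c).
Proof.
apply: (ptime_comp (g := fun m => nseq m c)).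
apply: (ptime_ext (f := fun m : nat => iter m (cons c) [::])); last by elim=> //= m ->.
have [K hK] : polyb (fun n => (esize c).+1) by exact: polyb_const.
apply: (ptime_iter_mu (f := fun _ => cons c) (I := fun _ _ => True)
     (mu := fun _ n => esize n) (k := 10 + K)).
- by pt.
- by pt.
- by pt.
- by move=> e; split=> //; exact: bnd_gt0.
- move=> e a _; split=> //; rewrite esize_cons.
  pose proof (hK (esize e)); pose proof (bnd_monok (esize e) (leq_addl 10 K)); lia.
- move=> e a _; apply: leq_trans (bnd_monok _ (leq_addr K 10)).
  by apply: bnd10_le; lia.
Qed.

Ltac pt1 ::= lazymatch goal with
  | |- ptime (fun _ => size _) => apply: ptime_size
  | |- ptime size => exact: ptime_size (ptime_id _)
  | |- ptime (fun _ => addn _ _) => apply: ptime_addn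
  | |- ptime (fun _ => predn _) => apply: ptime_pred
  | |- ptime (fun _ => subn _ _) => apply: ptime_subn
  | |- ptime (fun _ => leq _ _) => apply: ptime_leq
  | |- ptime (fun _ => maxn _ _) => apply: ptime_maxn
  | |- ptime (fun _ => drop _ _) => apply: ptime_drop
  | |- ptime (fun _ => catrev _ _) => apply: ptime_catrev
  | |- ptime (fun _ => rev _) => apply: ptime_rev
  | |- ptime (fun _ => nseq _ _) => apply: ptime_nseq
  end.

(** * The indexing algorithm *)

(** Least significant digit first, as in [bin_pos] and as carries propagate. *)
Definition bval (x : seq bool) : nat := foldr (fun (b : bool) m => b + m.*2) 0 x.

Lemma bval_split x : bval x = head false x + (bval (behead x)).*2.
Proof. by case: x. Qed.

(** The state holds the remaining digits of both summands, the carry, and the digits of the sum with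
    the latest first. An exhausted summand supplies [false]. *)
Definition add_step (st : seq bool * seq bool * bool * seq bool) :=
  (behead st.1.1.1, behead st.1.1.2,
   (if head false st.1.1.1 then head false st.1.1.2 || st.1.2
    else head false st.1.1.2 && st.1.2),
   (head false st.1.1.1 (+) head false st.1.1.2 (+) st.1.2) :: st.2).

(** The extra round flushes the last carry. Each addition lengthens the longer summand by one digit
    only, so lengths grow additively along an iteration. *)
Definition adds (x y : seq bool) : seq bool :=
  rev (iter (maxn (size x) (size y)).+1 add_step (x, y, false, [::])).2.

Lemma size_iter_add n st : size (iter n add_step st).2 = n + size st.2.
Proof. by elim: n => //= n ->. Qed.

Lemma size_adds x y : size (adds x y) = (maxn (size x) (size y)).+1.
Proof. by rewrite size_rev size_iter_add addn0. Qed.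

Lemma bval_rev_cons b s : bval (rev (b :: s)) = bval (rev s) + 2 ^ size s * b.
Proof.
rewrite rev_cons -cats1 /bval foldr_cat -size_rev.
elim: (rev s) => [|d s' IH] /=; first by rewrite mul1n; case: b.
by rewrite IH expnS; lia.
Qed.

Lemma bval_iter_add n x y c o : size x <= n -> size y <= n ->
  bval (rev (iter n.+1 add_step (x, y, c, o)).2) =
  bval (rev o) + 2 ^ size o * (bval x + bval y + c).
Proof.
elim: n x y c o => [|n IH] x y c o hx hy.
  have -> : x = [::] by apply: size0nil; lia.
  have -> : y = [::] by apply: size0nil; lia.
  by rewrite bval_rev_cons.
rewrite iterSr {2}/add_step IH; [|by rewrite size_behead /=; lia..].
rewrite bval_rev_cons [size _]/= expnS (bval_split x) (bval_split y).
move: (bval (rev o)) (2 ^ _) (bval (behead x)) (bval (behead y)) => p q r t.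
by case: (head false x); case: (head false y); case: c; rewrite /=; lia.
Qed.

Lemma bval_adds x y : bval (adds x y) = bval x + bval y.
Proof. by rewrite /adds bval_iter_add ?leq_maxl ?leq_maxr //= mul1n addn0. Qed.

Definition ltb_step (st : seq bool * seq bool * bool) :=
  (behead st.1.1, behead st.1.2,
   if head false st.1.1 == head false st.1.2 then st.2 else head false st.1.2).

Definition ltv (x y : seq bool) : bool :=
  (iter (maxn (size x) (size y)) ltb_step (x, y, false)).2.

(** The verdict [r] on the lower digits acts like a carry: it decides whether a tie of the higher
    digits counts as less. *)
Lemma ltv_iter n x y (r : bool) : size x <= n -> size y <= n ->
  (iter n ltb_step (x, y, r)).2 = (bval x < bval y + r).
Proof.
elim: n x y r => [|n IH] x y r hx hy.
  have -> : x = [::] by apply: size0nil; lia.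
  have -> : y = [::] by apply: size0nil; lia.
  by case: r.
rewrite iterSr {2}/ltb_step IH; [|by rewrite size_behead /=; lia..].
rewrite (bval_split x) (bval_split y).
move: (bval (behead x)) (bval (behead y)) => p q.
by case: (head false x); case: (head false y); case: r; rewrite /=; lia.
Qed.

Lemma ltvE x y : ltv x y = (bval x < bval y).
Proof. by rewrite /ltv ltv_iter ?leq_maxl ?leq_maxr // addn0. Qed.

Lemma esize_behead T (HT : Enc T) (s : seq T) : esize (behead s) <= esize s.
Proof. by case: s => //= x s; rewrite esize_cons; lia. Qed.

Lemma ptime_adds A (HA : Enc A) (x y : A -> seq bool) :
  ptime x -> ptime y -> ptime (fun a => adds (x a) (y a)).
Proof.
apply: ptime_comp2; rewrite /adds; apply: ptime_rev; apply: ptime_snd.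
apply: (ptime_iter_mu (f := fun _ => add_step) (mu := fun _ st => size st.2) (k := 10)
  (I := fun e st => esize st.1.1.1 <= esize e /\ esize st.1.1.2 <= esize e)).
- by rewrite /add_step; pt.
- by pt.
- by pt.
- by move=> [p q]; rewrite esize_pair /=; split=> //; lia.
- move=> e [[[p q] c] o] /= [h1 h2]; split.
    by split; [apply: leq_trans h1|apply: leq_trans h2]; exact: esize_behead.
  by rewrite -addn1 leq_add2l bnd_gt0.
- move=> e [[[p q] c] o] /= [h1 h2]; apply: bnd10_le; rewrite !esize_pair.
  pose proof (esize_bits o); pose proof (esize_bool c); lia.
Qed.

Lemma ptime_ltv A (HA : Enc A) (x y : A -> seq bool) :
  ptime x -> ptime y -> ptime (fun a => ltv (x a) (y a)).
Proof.
apply: ptime_comp2; rewrite /ltv; apply: ptime_snd.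
apply: (ptime_iter_mu (f := fun _ => ltb_step) (mu := fun _ _ => 0) (k := 10)
  (I := fun e st => esize st.1.1 <= esize e /\ esize st.1.2 <= esize e)).
- by rewrite /ltb_step; pt.
- by pt.
- by pt.
- by move=> [p q]; rewrite esize_pair /=; split=> //; lia.
- move=> e [[p q] c] /= [h1 h2]; split=> //.
  by split; [apply: leq_trans h1|apply: leq_trans h2]; exact: esize_behead.
- move=> e [[p q] c] /= [h1 h2]; apply: bnd10_le; rewrite !esize_pair.
  pose proof (esize_bool c); lia.
Qed.

(** * Powers of the transfer matrix *)

Definition sumw (w : seq bool) (v : seq (seq bool)) : seq bool :=
  (foldl (fun st (b : bool) => (behead st.1, if b then st.2 else adds st.2 (head [::] st.1)))
     (v, [::]) w).2.

Lemma esize_head (v : seq (seq bool)) : esize (head [::] v) <= esize v.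
Proof. by case: v => //= x s; rewrite esize_cons; lia. Qed.

Ltac pt1 ::= lazymatch goal with
  | |- ptime (fun _ => size _) => apply: ptime_size
  | |- ptime size => exact: ptime_size (ptime_id _)
  | |- ptime (fun _ => addn _ _) => apply: ptime_addn
  | |- ptime (fun _ => predn _) => apply: ptime_pred
  | |- ptime (fun _ => subn _ _) => apply: ptime_subn
  | |- ptime (fun _ => leq _ _) => apply: ptime_leq
  | |- ptime (fun _ => maxn _ _) => apply: ptime_maxn
  | |- ptime (fun _ => drop _ _) => apply: ptime_drop
  | |- ptime (fun _ => catrev _ _) => apply: ptime_catrev
  | |- ptime (fun _ => rev _) => apply: ptime_rev
  | |- ptime (fun _ => nseq _ _) => apply: ptime_nseq
  | |- ptime (fun _ => adds _ _) => apply: ptime_adds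
  | |- ptime (fun _ => ltv _ _) => apply: ptime_ltv
  end.

Lemma ptime_sumw A (HA : Enc A) (w : A -> seq bool) (v : A -> seq (seq bool)) :
  ptime w -> ptime v -> ptime (fun a => sumw (w a) (v a)).
Proof.
apply: ptime_comp2; rewrite /sumw; apply: ptime_snd.
apply: (ptime_foldl_mu (mu := fun _ st => size st.2) (k := 10)
  (f := fun (_ : seq bool * seq (seq bool)) st (b : bool) => (behead st.1, if b then st.2 else adds st.2 (head [::] st.1)))
  (I := fun e st => esize st.1 <= esize e)).
- by pt.
- by pt.
- by pt.
- by move=> [p q]; rewrite esize_pair /=; split=> //; lia.
- move=> e [u o] b /= h1 _; split; first by apply: leq_trans h1; exact: esize_behead.
  case: b; first by rewrite leq_addr.
  rewrite size_adds.
  pose proof (esize_head u); have := @size_le_esize _ enc_bool (head [::] u).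
  pose proof (bnd10 (esize e)); lia.
- move=> e [u o] /= h1; apply: bnd10_le; rewrite !esize_pair.
  pose proof (esize_bits o); lia.
Qed.

(** One letter more. State 0 is entered from the states [t] where [w] has a 0, on reading 1, which
    gives the sum; any state [t.+1] is entered only from [t], which makes the other entries a
    shift. *)
Definition stepv (w : seq bool) (v : seq (seq bool)) := sumw w v :: v.

Definition msize (v : seq (seq bool)) : nat := foldr (fun x m => maxn (size x) m) 0 v.

Lemma msize_head v : size (head [::] v) <= msize v.
Proof. by case: v => //= x s; rewrite leq_maxl. Qed.

Lemma msize_behead v : msize (behead v) <= msize v.
Proof. by case: v => //= x s; rewrite leq_maxr. Qed.

Lemma size_sumw w v : size (sumw w v) <= msize v + size w.
Proof.
suff h o : size (foldl
   (fun st (b : bool) => (behead st.1, if b then st.2 else adds st.2 (head [::] st.1)))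
     (v, o) w).2 <= maxn (size o) (msize v) + size w by have := h [::]; rewrite max0n.
elim: w v o => [|b w IH] v o /=; first by rewrite addn0 leq_maxl.
apply: leq_trans (IH _ _) _.
have := msize_head v; have := msize_behead v.
by case: b; rewrite ?size_adds; lia.
Qed.

Lemma ptime_stepv A (HA : Enc A) (w : A -> seq bool) (v : A -> seq (seq bool)) :
  ptime w -> ptime v -> ptime (fun a => stepv (w a) (v a)).
Proof. by move=> hw hv; apply: ptime_cons => //; apply: ptime_sumw. Qed.

Lemma esize_msize v : esize v <= size v * (4 * msize v + 2) + 1.
Proof.
elim: v => // x v IH; rewrite esize_cons /=; pose proof (esize_bits x).
have h : size v * (4 * msize v + 2) <= size v * (4 * maxn (size x) (msize v) + 2).
  by rewrite leq_mul2l; apply/orP; right; lia.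
lia.
Qed.

Lemma msize_esize v : msize v <= esize v.
Proof.
by elim: v => // x v IH; rewrite esize_cons /=; have := @size_le_esize _ enc_bool x; lia.
Qed.

Definition plist (w : seq bool) (d : nat) (v : seq (seq bool)) := iter d (stepv w) v.

Lemma ptime_plist A (HA : Enc A) (w : A -> seq bool) (d : A -> nat) (v : A -> seq (seq bool)) :
  ptime w -> ptime d -> ptime v -> ptime (fun a => plist (w a) (d a) (v a)).
Proof.
move=> hw hd hv.
apply: (ptime_comp (f := fun a => (w a, (d a, v a))) (g := fun p => plist p.1 p.2.1 p.2.2)); last by pt.
rewrite /plist.
have [K hK] : polyb (fun n => n * (4 * n + 2) + 1) by polyb.
apply: (ptime_iter_mu (mu := fun _ v => size v + msize v) (k := 10 + K)
  (f := fun (p : seq bool * (nat * seq (seq bool))) => stepv p.1)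
  (I := fun _ _ => True)).
- by apply: ptime_stepv; pt.
- by pt.
- by pt.
- move=> [p [q u]]; split=> //; apply: leq_trans (bnd_monok _ (leq_addr K 10)).
  apply: bnd10_le; rewrite !esize_pair /=.
  pose proof (@size_le_esize _ _ u); pose proof (msize_esize u); lia.
- move=> [p [q u]] a _; split=> //=.
  pose proof (size_sumw p a); pose proof (@size_le_esize _ enc_bool p).
  pose proof (bnd_monok (esize (p, (q, u))) (leq_addr K 10)).
  pose proof (bnd10 (esize (p, (q, u)))); pose proof (esize_pair _ _ p (q, u)); lia.
- move=> e a _; apply: leq_trans (bnd_monok _ (leq_addl 10 K)).
  apply: leq_trans (bnd_mono _ (leq_addl (esize e) _)).
  apply: leq_trans (hK _); apply: leq_trans (esize_msize a) _.
  by rewrite leq_add2r leq_mul //; lia.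
Qed.

(* [ncons s [::] [:: [:: true]]] is the unit vector of state [s]; no truncation at length
   [size w] is needed because entries beyond it never flow back. *)
Definition trs (w : seq bool) (d s : nat) : seq bool :=
  head [::] (drop s (plist w d (ncons s [::] [:: [:: true]]))).

Lemma ptime_trs A (HA : Enc A) (w : A -> seq bool) (d s : A -> nat) :
  ptime w -> ptime d -> ptime s -> ptime (fun a => trs (w a) (d a) (s a)).
Proof.
move=> hw hd hs; apply: ptime_head; apply: ptime_drop => //; apply: ptime_plist => //.
apply: (ptime_ext (f := fun a => catrev (nseq (s a) [::]) [:: [:: true]])).
  by pt.
by move=> a; rewrite catrevE rev_nseq cat_nseq.
Qed.

Definition tr_step (w : seq bool) (d : nat) (st : nat * seq bool) :=
  (st.1.-1, adds st.2 (trs w d st.1.-1)).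

Definition tr (w : seq bool) (d : nat) : seq bool :=
  (iter (size w) (tr_step w d) (size w, [::])).2.

Lemma ptime_tr A (HA : Enc A) (w : A -> seq bool) (d : A -> nat) :
  ptime w -> ptime d -> ptime (fun a => tr (w a) (d a)).
Proof.
apply: ptime_comp2; rewrite /tr; apply: ptime_snd.
have ht : ptime (fun p : seq bool * nat * nat => trs p.1.1 p.1.2 p.2) by apply: ptime_trs; pt.
(* The size bound inside [ptime] limits the length of each summand; the argument [n + 2 * n + 3]
   below leaves room for a unary state number up to the length of [w]. *)
have [F [k hk]] := ht.
have [K hK] : polyb (fun n => (bnd k (n + 2 * n + 3)).+1) by polyb.
apply: (ptime_iter_mu (mu := fun _ st => size st.2) (k := 10 + K)
  (f := fun (p : seq bool * nat) => tr_step p.1 p.2)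
  (I := fun e st => st.1 <= size e.1)).
- by apply: ptime_pair; [by pt|apply: ptime_adds; [by pt|apply: ptime_trs; by pt]].
- by pt.
- by pt.
- by move=> e.
- move=> [p q] [s o] /= h; split; first by lia.
  rewrite size_adds.
  have [h1 _] := hk (p, q, s.-1).
  have h2 := @size_le_esize _ enc_bool (trs p q s.-1).
  pose proof (hK (esize (p, q))) as h3.
  pose proof (bnd_monok (esize (p, q)) (leq_addl 10 K)) as h4.
  have h5 : bnd k (esize (p, q, s.-1)) <= bnd k (esize (p, q) + 2 * esize (p, q) + 3).
    apply: bnd_mono; rewrite !esize_pair !esize_nat.
    pose proof (@size_le_esize _ enc_bool p); lia.
  rewrite /= in h1; lia.
- move=> [p q] [s o] /= h; apply: leq_trans (bnd_monok _ (leq_addr K 10)).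
  apply: bnd10_le; rewrite !esize_pair esize_nat.
  pose proof (@size_le_esize _ enc_bool p); pose proof (esize_bits o); lia.
Qed.

Definition gcd_step (p : nat * nat) :=
  if p.1 <= p.2 then (p.1, p.2 - p.1) else (p.1 - p.2, p.2).

(** Subtractive Euclid: the sum of the entries drops until one of them is 0, and such a pair is
    stable, so [a + b] rounds suffice and the final sum is the gcd. *)
Definition gcdb (a b : nat) : nat :=
  (iter (a + b) gcd_step (a, b)).1 + (iter (a + b) gcd_step (a, b)).2.

Lemma ptime_gcdb A (HA : Enc A) (a b : A -> nat) :
  ptime a -> ptime b -> ptime (fun x => gcdb (a x) (b x)).
Proof.
apply: ptime_comp2.
have h : ptime (fun p : nat * nat => iter (p.1 + p.2) gcd_step (p.1, p.2)).
  apply: (ptime_iter_mu (mu := fun _ _ => 0) (k := 10) (f := fun _ => gcd_step)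
    (I := fun (e st : nat * nat) => st.1 <= e.1 /\ st.2 <= e.2)).
  - by rewrite /gcd_step; pt.
  - by pt.
  - by pt.
  - by move=> e.
  - by move=> [p q] [s t] [/= h1 h2]; split=> //; rewrite /gcd_step; case: ifP => /=; lia.
  - by move=> [p q] [s t] [/= h1 h2]; apply: bnd10_le; rewrite !esize_pair !esize_nat; lia.
by apply: ptime_addn; [apply: ptime_fst|apply: ptime_snd].
Qed.

Lemma gcdbE a b : gcdb a b = gcdn a b.
Proof.
suff h n x y : x + y <= n ->
    (iter n gcd_step (x, y)).1 + (iter n gcd_step (x, y)).2 = gcdn x y by exact: h.
have h0 m z : (iter m gcd_step (0, z) = (0, z)) * (iter m gcd_step (z, 0) = (z, 0)).
  split; elim: m => //= m ->; rewrite /gcd_step /= ?subn0 //.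
  by case: z.
elim: n x y => [|n IH] x y hn.
  by have [-> ->] : x = 0 /\ y = 0 by lia.
have [->|x0] := posnP x; first by rewrite h0 gcd0n.
have [->|y0] := posnP y; first by rewrite h0 gcdn0 addn0.
rewrite iterSr {2 4}/gcd_step /=; case: leqP => hxy.
  rewrite IH; last by lia.
  by rewrite -{2}(subnK hxy) gcdnDr.
rewrite IH; last by lia.
by rewrite gcdnC [RHS]gcdnC -{2}(subnK (ltnW hxy)) gcdnDr.
Qed.

Definition cnt_step (w : seq bool) (st : nat * seq bool) :=
  (st.1.-1, adds st.2 (tr w (gcdb st.1 (size w)))).

(** The shift runs through [n, ..., 1]; the rotation by [n] stands for the identity. *)
Definition cnt (w : seq bool) : seq bool :=
  (iter (size w) (cnt_step w) (size w, [::])).2.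

Lemma ptime_cnt A (HA : Enc A) (w : A -> seq bool) :
  ptime w -> ptime (fun a => cnt (w a)).
Proof.
apply: ptime_comp; rewrite /cnt; apply: ptime_snd.
have ht : ptime (fun p : seq bool * nat => tr p.1 (gcdb p.2 (size p.1))).
  by apply: ptime_tr; [by pt|apply: ptime_gcdb; by pt].
have [F [k hk]] := ht.
have [K hK] : polyb (fun n => (bnd k (n + 2 * n + 3)).+1) by polyb.
apply: (ptime_iter_mu (mu := fun _ st => size st.2) (k := 10 + K)
  (f := cnt_step) (I := fun w st => st.1 <= size w)).
- apply: ptime_pair; first by pt.
  by apply: ptime_adds; [by pt|apply: ptime_tr; [by pt|apply: ptime_gcdb; by pt]].
- by pt.
- by pt.
- by move=> e.
- move=> p [s o] /= h; split; first by lia.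
  rewrite size_adds.
  have [h1 _] := hk (p, s).
  have h2 := @size_le_esize _ enc_bool (tr p (gcdb s (size p))).
  pose proof (hK (esize p)) as h3.
  pose proof (bnd_monok (esize p) (leq_addl 10 K)) as h4.
  have h5 : bnd k (esize (p, s)) <= bnd k (esize p + 2 * esize p + 3).
    apply: bnd_mono; rewrite !esize_pair !esize_nat.
    pose proof (@size_le_esize _ enc_bool p); lia.
  rewrite /= in h1; lia.
- move=> p [s o] /= h; apply: leq_trans (bnd_monok _ (leq_addr K 10)).
  apply: bnd10_le; rewrite !esize_pair esize_nat.
  pose proof (@size_le_esize _ enc_bool p); pose proof (esize_bits o); lia.
Qed.

Definition ltx_step (st : seq bool * (bool * bool)) (b : bool) :=
  (behead st.1,
   if st.2.1 then st.2 else if b == head false st.1 then (false, false) else (true, ~~ b)).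

Definition ltxb (v w : seq bool) : bool := (foldl ltx_step (w, (false, false)) v).2.2.

Lemma ptime_ltxb A (HA : Enc A) (v w : A -> seq bool) :
  ptime v -> ptime w -> ptime (fun a => ltxb (v a) (w a)).
Proof.
apply: ptime_comp2; rewrite /ltxb; do 2!apply: ptime_snd.
apply: (ptime_foldl_mu (mu := fun _ _ => 0) (k := 10) (f := fun _ => ltx_step)
  (I := fun e st => esize st.1 <= esize e)).
- by rewrite /ltx_step; pt.
- by pt.
- by pt.
- by move=> [p q]; rewrite esize_pair /=; split=> //; lia.
- by move=> e [u o] b /= h _; split=> //; apply: leq_trans h; exact: esize_behead.
- move=> e [u [o o']] /= h; apply: bnd10_le; rewrite !esize_pair.
  pose proof (esize_bool o); pose proof (esize_bool o'); lia.
Qed.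

Definition prenb (w : seq bool) : bool :=
  (iter (size w) (fun st => (behead st.1, st.2 && ~~ ltxb st.1 w)) (w, true)).2.

Lemma ptime_prenb A (HA : Enc A) (w : A -> seq bool) :
  ptime w -> ptime (fun a => prenb (w a)).
Proof.
apply: ptime_comp; rewrite /prenb; apply: ptime_snd.
apply: (ptime_iter_mu (mu := fun _ _ => 0) (k := 10)
  (f := fun w (st : seq bool * bool) => (behead st.1, st.2 && ~~ ltxb st.1 w))
  (I := fun e st => esize st.1 <= esize e)).
- by pt; apply: ptime_ltxb; pt.
- by pt.
- by pt.
- by move=> e.
- by move=> e [u o] /= h; split=> //; apply: leq_trans h; exact: esize_behead.
- move=> e [u o] /= h; apply: bnd10_le; rewrite !esize_pair.
  pose proof (esize_bool o); lia.
Qed.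

Definition mulj (n : nat) (j : seq bool) : seq bool := iter n (adds j) [::].

Lemma bval_mulj n j : bval (mulj n j) = n * bval j.
Proof. by elim: n => // n IH; rewrite /mulj iterS bval_adds -/(mulj n j) IH mulSn. Qed.

Lemma ptime_mulj A (HA : Enc A) (n : A -> nat) (j : A -> seq bool) :
  ptime n -> ptime j -> ptime (fun a => mulj (n a) (j a)).
Proof.
apply: ptime_comp2; rewrite /mulj.
apply: (ptime_iter_mu (mu := fun _ s => size s) (k := 10)
  (f := fun (p : nat * seq bool) => adds p.2) (I := fun _ _ => True)).
- by apply: ptime_adds; pt.
- by pt.
- by pt.
- by move=> e.
- move=> [p q] a _; split=> //=; rewrite size_adds.
  pose proof (@size_le_esize _ enc_bool q); pose proof (bnd10 (esize (p, q))).
  pose proof (esize_pair _ _ p q); lia.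
- move=> e a _; apply: bnd10_le; pose proof (esize_bits a); lia.
Qed.

(** [st.1] holds the letters found, last one first, and [st.2] one [true] for each letter still
    open. The probe is the greatest word that continues the letters found by a 0. *)
Definition probe (st : seq bool * seq bool) : seq bool := catrev st.1 (false :: behead st.2).

(** If fewer than [j] necklaces lie above the probe, the least word with this property is at most
    the probe, and the letter is 0. The answer 1 for a probe that is not [pren] rests on
    [num_ge_not_pren]. *)
Definition search_step (t : seq bool) (st : seq bool * seq bool) :=
  (~~ (prenb (probe st) && ltv (cnt (probe st)) t) :: st.1, behead st.2).

Definition search (n : nat) (t : seq bool) : seq bool :=
  (iter n (search_step t) ([::], nseq n true)).1.

Lemma ptime_search A (HA : Enc A) (n : A -> nat) (t : A -> seq bool) :
  ptime n -> ptime t -> ptime (fun a => search (n a) (t a)).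
Proof.
apply: ptime_comp2; rewrite /search; apply: ptime_fst.
apply: (ptime_iter_mu (mu := fun _ st => size st.1) (k := 10)
  (f := fun (p : nat * seq bool) => search_step p.2)
  (I := fun p st => size st.2 <= p.1)).
- have hp : ptime (fun p : nat * seq bool * (seq bool * seq bool) => probe p.2).
    by rewrite /probe; pt.
  by rewrite /search_step; pt; [apply: ptime_prenb|apply: ptime_cnt].
- by pt.
- by pt.
- by move=> [p q] /=; rewrite size_nseq.
- by move=> e [u v] /= h; rewrite -addn1 leq_add2l bnd_gt0 size_behead; split=> //; lia.
- move=> [p q] [u v] /= h; apply: bnd10_le; rewrite !esize_pair !esize_nat.
  pose proof (esize_bits u); pose proof (esize_bits v); lia.
Qed.

(* The digits of the index come most significant first and the letters of the necklace
   last first: this is the order in which a stack receives and delivers them. *)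
Definition index_necklace (p : seq bool * nat) : bool * seq bool :=
  let t := mulj p.2 (rev p.1) in
  (ltv (adds (cnt (nseq p.2 false)) (mulj p.2 [:: true])) t, search p.2 t).

Lemma ptime_index_necklace : ptime index_necklace.
Proof.
have ht : ptime (fun p : seq bool * nat => mulj p.2 (rev p.1)) by apply: ptime_mulj; pt.
rewrite /index_necklace; pt; last by apply: ptime_search; pt.
- by apply: ptime_cnt; pt.
- by apply: ptime_mulj; pt.
Qed.

(** * The automaton *)

(* [false] when one of the words is a prefix of the other. *)
Fixpoint ltx (v w : seq bool) : bool :=
  match v, w with
  | a :: v', b :: w' => if a == b then ltx v' w' else ~~ a
  | _, _ => false
  end.

Lemma ltxP v w : reflect
  (exists t, [/\ t < size v, t < size w, forall i, i < t -> nth false v i = nth false w i,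
     nth false v t = false & nth false w t = true]) (ltx v w).
Proof.
elim: v w => [|a v IH] [|b w] /=; try by constructor=> -[t []].
case: eqP => [->|ab].
  apply: (iffP (IH w)) => -[t [h1 h2 h3 h4 h5]].
    by exists t.+1; split=> // -[|i] //=; apply: h3.
  case: t h1 h2 h3 h4 h5 => [|t] /=; first by move=> _ _ _ ->.
  by move=> h1 h2 h3 h4 h5; exists t; split=> // i hi; apply: (h3 i.+1).
apply: (iffP idP).
  by case: a b ab => -[] // _ _; exists 0; split.
move=> [[|t] [h1 h2 h3 h4 h5]]; first by rewrite /= in h4; rewrite h4.
by have := h3 0 isT.
Qed.

Lemma ltx_irr v : ltx v v = false.
Proof. by elim: v => //= a v ->; rewrite eqxx. Qed.

Lemma ltx_asym v w : ltx v w -> ltx w v = false.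
Proof. by elim: v w => [|a v IH] [|b w] //=; case: a; case: b => //=; apply: IH. Qed.

Lemma ltx_total v w : size v = size w -> v != w -> ltx v w || ltx w v.
Proof.
elim: v w => [|a v IH] [|b w] //= [hs] hvw.
have := IH w hs; move: hvw; case: a; case: b => //=; rewrite eqseq_cons /= => -> /(_ isT);
  by case: (ltx v w).
Qed.

Lemma ltx_cat v w z : size v <= size w -> ltx v (w ++ z) = ltx v w.
Proof. by elim: v w => [|a v IH] [|b w] //= h; rewrite IH. Qed.

Lemma ltxbE v w : ltxb v w = ltx v w.
Proof.
rewrite /ltxb; set f := ltx_step.
have h (p : bool) u v' : (foldl f (u, (true, p)) v').2.2 = p.
  by elim: v' u => //= a v' IH u; rewrite {2}/f /ltx_step /= IH.
elim: v w => [|a v IH] [|b w] //=; rewrite {2}/f /ltx_step /=; last first.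
  by case: eqP => //= _; rewrite h.
case: a; rewrite /= ?h //.
(* Once [w] is exhausted it supplies [false], below which no letter of [v] can fall. *)
have -> : forall v', (foldl f ([::], (false, false)) v').2.2 = false => //.
by elim=> // -[] v' IH'; rewrite /= {2}/f /ltx_step //= h.
Qed.

(** These are the prenecklaces, that is, the prefixes of powers of Lyndon words. Suffixes that are
    prefixes of [w] are allowed, since [ltx] is then false. *)
Definition pren (w : seq bool) := forall r, ~~ ltx (drop r w) w.

Lemma prenbE w : prenb w = all (fun r => ~~ ltx (drop r w) w) (iota 0 (size w)).
Proof.
rewrite /prenb; set f := fun st : seq bool * bool => _.
suff h n u b : (iter n f (u, b)).2 = b && all (fun r => ~~ ltx (drop r u) w) (iota 0 n) by exact: h.
elim: n u b => [|n IH] u b; first by rewrite andbT.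
rewrite iterSr IH /= drop0 ltxbE -andbA (iotaDl 1 0) all_map; congr (_ && (_ && _)).
by apply: eq_all => r /=; rewrite -drop1 drop_drop addn1.
Qed.

Lemma prenbP w : reflect (pren w) (prenb w).
Proof.
rewrite prenbE; apply: (iffP allP) => [H r|H r _]; last exact: H.
have [hr|hr] := ltnP r (size w); first by apply: H; rewrite mem_iota.
by rewrite drop_oversize.
Qed.

Lemma prenbPn w : ~~ prenb w -> exists r, ltx (drop r w) w.
Proof. by rewrite prenbE => /allPn[r _ /negPn h]; exists r. Qed.

Section Automaton.
Variable w : seq bool.
Local Notation n := (size w).
Local Notation "w `[ i ]" := (nth false w i) (at level 2).

(* Reading a stream none of whose windows is [<= w], the state is the length of the
   longest suffix read that is a prefix of [w]. *)
Definition delta (s : nat) (c : bool) : option nat :=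
  if s < n then if c == w`[s] then Some s.+1 else if c then Some 0 else None else None.

Fixpoint go (s : nat) (z : seq bool) : option nat :=
  if z is c :: z' then obind (fun s' => go s' z') (delta s c) else Some s.

Lemma go_cat s a b : go s (a ++ b) = obind (fun s' => go s' b) (go s a).
Proof. by elim: a s => //= c a IH s; case: (delta s c). Qed.

(** The prefix of [w] of length [s] is a suffix of the prefix of length [s']; equality is
    included. *)
Definition border s s' := s <= s' <= n /\ forall i, i < s -> w`[i] = w`[s' - s + i].

Lemma border0 s : s <= n -> border 0 s.
Proof. by move=> h; split. Qed.

Hypothesis hw : pren w.

(** Letter [s] of [w] is at most letter [s'], for otherwise the suffix starting at [s' - s] would be
    below [w]. So a letter that survives at [s'] survives at [s], and an upward mismatch at [s'] is
    one at [s]. *)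
Lemma border_step s s' c t' : border s s' -> delta s' c = Some t' ->
  exists2 t, delta s c = Some t & border t t'.
Proof.
move=> [/andP[hs hs'] hb]; rewrite /delta; case: ltnP => // h'.
have h : s < n by lia.
have key : ~ (w`[s'] = false /\ w`[s] = true).
  move=> [k1 k2]; have /negP := hw (s' - s); apply; apply/ltxP; exists s.
  rewrite size_drop; split=> //; first by lia.
    by move=> i hi; rewrite nth_drop -hb.
  by rewrite nth_drop subnK.
rewrite h; case: eqP => [->|/eqP hc].
  move=> [<-]; case: eqP => [e|/eqP e].
    exists s.+1 => //; split=> [|i]; first by lia.
    rewrite ltnS leq_eqVlt subSS => /orP[/eqP ->|hi]; last by rewrite hb.
    by rewrite subnK.
  move: key e; case: (w`[s']); case: (w`[s]) => // key _.
    by exists 0 => //; exact: border0.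
  by case: key.
case: c hc => // hc [<-]; exists 0; last exact: border0.
by move: key hc; case: (w`[s']); case: (w`[s]) => //= key; case: key.
Qed.

Lemma border_go s s' z t' : border s s' -> go s' z = Some t' ->
  exists2 t, go s z = Some t & border t t'.
Proof.
elim: z s s' => [|c z IH] s s' hb /=; first by case=> <-; exists s.
case e : (delta s' c) => [s1|] //=.
by have [t -> /= ht] := border_step hb e; apply: IH.
Qed.

(** The run from [s] has a mismatch among its first [n - s + 1] letters, since more matches would
    lead beyond state [n], where it dies. The mismatch sends it to 0, and the other run, being in a
    border of 0, is in 0 as well. *)
Lemma go_sync s0 s z t : border s0 s -> go s z = Some t -> n - s < size z -> go s0 z = Some t.
Proof.
elim: z s0 s => [|c z IH] s0 s //= hb; case e : (delta s c) => [s1|] //=.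
have [t0 -> /= ht] := border_step hb e.
move=> hg hz; move: e ht; rewrite /delta; case: ltnP => // hs.
case: eqP => _; first by case=> e1 ht; subst s1; apply: (IH _ _ ht hg); lia.
by case: (c) => // -[e1] [/andP[ht _] _]; have -> : t0 = s1 by lia.
Qed.

Definition rep k (y : seq bool) := flatten (nseq k y).

Lemma size_rep k y : size (rep k y) = k * size y.
Proof. by elim: k => //= k IH; rewrite /rep /= size_cat IH mulSn. Qed.

Lemma rep_comm k y : y ++ rep k y = rep k y ++ y.
Proof. by elim: k => [|k IH]; [rewrite cats0|rewrite /rep /= -/(rep k y) {1}IH catA]. Qed.

Lemma go_rep k s y : go s y = Some s -> go s (rep k y) = Some s.
Proof. by move=> h; elim: k => //= k IH; rewrite go_cat h. Qed.

(** The exponent makes the power longer than [n] even if [y] is a single letter. *)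
Lemma go_fix_sync s (y : seq bool) : s <= n -> y != [::] -> go s y = Some s -> go 0 (rep n.+1 y) = Some s.
Proof.
move=> hs hy h; apply: go_sync (border0 hs) (go_rep _ h) _.
have y0 : 0 < size y by case: (y) hy.
by rewrite size_rep mulSn; have := leq_pmulr n y0; lia.
Qed.

Lemma go_fix_lt s (y : seq bool) : y != [::] -> go s y = Some s -> s < n.
Proof. by case: y => //= c y _; rewrite /delta; case: ltnP. Qed.

Lemma go_fix_unique s s' (y : seq bool) : y != [::] -> go s y = Some s -> go s' y = Some s' -> s = s'.
Proof.
move=> hy h h'.
have e := go_fix_sync (ltnW (go_fix_lt hy h)) hy h.
have := go_fix_sync (ltnW (go_fix_lt hy h')) hy h'.
by rewrite e => -[].
Qed.

(** A surviving run of this length contains a mismatch, and the first one is upward. *)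
Lemma go_ltx s z : s <= n -> n - s < size z -> go s z -> ltx (drop s w) z.
Proof.
elim: z s => [|c z IH] s //= hs hz; rewrite /delta; case: ltnP => // h.
rewrite (drop_nth false) //=; case: eqP => [->|/eqP hc] /=.
  by rewrite eqxx; apply: IH; lia.
by move: hc; case: (c) => //=; case: (w`[s]).
Qed.

Lemma go_fix_ltx s (x : seq bool) : size x = n -> x != [::] -> go s x = Some s -> ltx w x.
Proof.
move=> hx x0 h; have hs := go_fix_lt x0 h.
have e := go_fix_sync (ltnW hs) x0 h.
(* A run of just [n] letters could match [w] throughout and end alive in state [n]; the further
   copies of [x] exclude this. *)
have : ltx (drop 0 w) (x ++ rep n x).
  apply: go_ltx => //; last by rewrite (_ : x ++ rep n x = rep n.+1 x) // e.
  rewrite size_cat size_rep hx; have x1 : 0 < n by rewrite -hx; case: (x) x0.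
  by have := leq_pmulr n x1; lia.
by rewrite drop0 ltx_cat // hx.
Qed.

Lemma go_fix_rot s (x : seq bool) k : size x = n -> x != [::] -> go s x = Some s -> ltx w (rot k x).
Proof.
move=> hx x0 h; move: (h); rewrite -{1}(cat_take_drop k x) go_cat.
case e : (go s (take k x)) => [s1|] //= h1.
apply: (@go_fix_ltx s1); rewrite ?size_rot //.
  by rewrite -size_eq0 size_rot size_eq0.
by rewrite /rot go_cat h1.
Qed.

Lemma window_rep x K i : size x = n -> (forall k, ltx w (rot k x)) ->
  i + n <= K * n -> ltx w (take n (drop i (rep K x))).
Proof.
move=> hx hr; elim: K i => [|K IH] i hi.
  have w0 : n = 0 by lia.
  have := hr 0; have := size0nil w0 => ->; by case: (rot 0 x).
have [hin|hin] := ltnP i n; last first.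
  have -> : drop i (rep K.+1 x) = drop (i - n) (rep K x).
    by rewrite /rep /= drop_cat hx ltnNge hin.
  by apply: IH; lia.
suff -> : take n (drop i (rep K.+1 x)) = rot i x by apply: hr.
rewrite {1}/rep /= -/(rep K x) drop_cat hx hin take_cat size_drop hx /rot.
have -> : n < n - i = false by lia.
congr (_ ++ _); have -> : n - (n - i) = i by lia.
case: i hi hin {IH} => [|i] hi hin; first by rewrite !take0.
case: K hi => [|K] hi; first by lia.
by rewrite /rep /= take_cat hx hin.
Qed.

(** The unread part [z'] is long enough for the window that begins with the current partial match to
    lie inside [X]. That this window is above [w] rules out a downward mismatch and a complete
    match. *)
Lemma go_window X z z' : 0 < n ->
  (forall i, i + n <= size X -> ltx w (take n (drop i X))) ->
  X = z ++ z' -> n <= size z' ->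
  exists s, [/\ s < n, s <= size z, go 0 z = Some s & drop (size z - s) z = take s w].
Proof.
move=> n0 hX; elim/last_ind: z z' => [|z c IH] z' eX hz'; first by exists 0; rewrite take0.
have [||s [h1 h2 h3 h4]] := IH (c :: z'); [by rewrite eX cat_rcons|by rewrite /=; lia|].
have : ltx w (take n (drop (size z - s) X)).
  by apply: hX; rewrite eX !size_cat size_rcons; lia.
have -> : take n (drop (size z - s) X) = take s w ++ c :: take (n - s.+1) z'.
  rewrite eX cat_rcons drop_cat; case: ltnP => hh.
    rewrite h4 take_cat size_take h1; have -> : n < s = false by lia.
    by have -> : n - s = (n - s.+1).+1 by lia.
  have s0 : s = 0 by lia.
  rewrite s0 subn0 subnn drop0 take0 /= subn1; by case: (n) n0.
rewrite -{1}(cat_take_drop s w) (drop_nth false h1).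
have hl u v : ltx (take s w ++ u) (take s w ++ v) = ltx u v.
  by elim: (take s w) => //= b t ->; rewrite eqxx.
rewrite hl /= => hc.
rewrite -cats1 go_cat h3 /= /delta h1.
case: eqP hc => [ec hlt|ne hc].
  rewrite ec eqxx; exists s.+1; rewrite size_cat addn1 subSS; split=> //.
  - rewrite ltn_neqAle h1 andbT; apply/eqP => e.
    by move: hlt; rewrite drop_oversize ?e.
  - rewrite drop_cat; case: ltnP => hh; first by rewrite h4 cats1 (take_nth false h1) ?ec.
    have s0 : s = 0 by lia.
    by rewrite s0 subn0 subnn drop0 /= (take_nth false) -?s0 // ec s0 take0.
case: eqP => [e|_]; first by case: ne.
rewrite (_ : c = true); last by case: (c) ne hc; case: (w`[s]).
by exists 0; rewrite subn0 take0 drop_size.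
Qed.

(** The states reached from 0 after successive powers of [x] form a chain of borders, hence do not
    decrease, and stay below [n]; so two consecutive ones agree. Until they do, the state after [k]
    copies is at least [k]. *)
Lemma ltx_fix x : 0 < n -> size x = n -> (forall k, ltx w (rot k x)) ->
  exists s, go s x = Some s.
Proof.
move=> n0 hx hr.
have st k : exists2 s, s < n & go 0 (rep k x) = Some s.
  have [||||s [h1 h2 h3 _]] := @go_window (rep k.+1 x) (rep k x) x => //; last by exists s.
  - by move=> i; rewrite size_rep hx; exact: window_rep.
  - by rewrite -rep_comm.
  - by rewrite hx.
have rS k : rep k.+1 x = rep k x ++ x by rewrite -rep_comm.
suff : forall k, (exists s, go s x = Some s) \/
    exists s s', [/\ go 0 (rep k x) = Some s, go s x = Some s', border s s' & k <= s].
  move=> /(_ n) [//|[s [s' [h1 _ _ h2]]]].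
  by have [s1 h3] := st n; rewrite h1 => -[e]; lia.
elim=> [|k [|[s [s' [h1 h2 h3 h4]]]]]; [|by left|].
  right; have [s1 h1] := st 1; rewrite /rep /= cats0 => h2.
  by exists 0, s1; split=> //; apply: border0; exact: ltnW.
have [e|ne] := eqVneq s s'; first by left; exists s; rewrite h2 e.
right; exists s'.
have [s2 h5 h6] := st k.+2; rewrite !rS -catA go_cat h1 /= go_cat h2 /= in h6.
exists s2; split=> //; first by rewrite rS go_cat h1.
  by have [t] := border_go h3 h6; rewrite h2 => -[<-].
by have [/andP[a _] _] := h3; lia.
Qed.

End Automaton.

(** * Counting necklaces *)

Lemma sum_rcons d (F : seq bool -> nat) :
  \sum_(y : d.+1.-tuple bool) F y =
  \sum_(y : d.-tuple bool) (F (rcons y false) + F (rcons y true)).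
Proof.
pose h (p : d.-tuple bool * bool) : d.+1.-tuple bool := [tuple of rcons p.1 p.2].
have hb : bijective h.
  apply: inj_card_bij; last by rewrite card_prod !card_tuple !card_bool expnSr.
  move=> [y c] [y' c'] /(congr1 val) /= /rcons_inj [e ->].
  by congr (_, _); apply: val_inj.
rewrite (reindex h); last exact: onW_bij.
rewrite (eq_bigr (fun p : d.-tuple bool * bool => F (rcons p.1 p.2))) //.
rewrite -(pair_bigA _ (fun (y : d.-tuple bool) c => F (rcons (val y) c))) /=.
by apply: eq_bigr => y _; rewrite big_bool addnC.
Qed.

Lemma bval_sumw w v :
  bval (sumw w v) = \sum_(t < size w) ~~ nth false w t * bval (nth [::] v t).
Proof.
rewrite /sumw; set f := fun _ _ => _.
suff h o : bval (foldl f (v, o) w).2 =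
    bval o + \sum_(t < size w) ~~ nth false w t * bval (nth [::] v t) by rewrite h.
elim: w v o => [|b w IH] v o /=; first by rewrite big_ord0 addn0.
rewrite IH big_ord_recl /= addnA; congr (_ + _).
  by rewrite /f /=; case: b; rewrite ?addn0 // bval_adds mul1n nth0.
by apply: eq_bigr => i _; rewrite /bump /= add1n -nth_behead.
Qed.

Definition walks w d s t := \sum_(y : d.-tuple bool) (go w s y == Some t).

Lemma walks_plist w d s t : t <= size w -> s <= size w ->
  bval (nth [::] (plist w d (ncons s [::] [:: [:: true]])) t) = walks w d s t.
Proof.
move=> ht hs; elim: d t ht => [|d IH] t ht.
  rewrite /plist /= /walks (big_pred1 [tuple]); last by move=> y; rewrite /= [y]tuple0; exact/esym/eqP.
  rewrite /= nth_ncons (inj_eq Some_inj); case: ltngtP => //.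
    by move=> h; case: (t - s) (subn_gt0 s t) => [|[|k]]; rewrite ?h.
  by move=> ->; rewrite subnn.
have es z : plist w d.+1 z = sumw w (plist w d z) :: plist w d z by [].
rewrite es /walks (sum_rcons d (fun z => nat_of_bool (go w s z == Some t))).
have e y c : go w s (rcons y c) = obind (fun u => delta w u c) (go w s y).
  by rewrite -cats1 go_cat; case: (go w s y) => //= u; case: (delta w u c).
case: t ht => [|t] ht /=.
  rewrite bval_sumw.
  rewrite (eq_bigr (fun t : 'I_(size w) => ~~ nth false w t * walks w d s t)); last by move=> t _; rewrite IH // ltnW.
  under eq_bigr => t _ do rewrite /walks big_distrr /=.
  rewrite exchange_big /=; apply: eq_bigr => y _; rewrite !e.
  case: (go w s y) => [u|] /=; last by rewrite big1 // => i _; rewrite muln0.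
  rewrite /delta; case: ltnP => hu; last first.
    by rewrite big1 // => i _; rewrite (_ : Some u == Some (i : nat) = false) ?muln0 //; apply/eqP => -[h]; have := ltn_ord i; lia.
  rewrite (bigD1 (Ordinal hu)) //= eqxx big1 => [|i /eqP hi].
    by case: (nth false w u).
  by rewrite (_ : Some u == Some (i : nat) = false) ?muln0 //; apply/eqP => -[h]; case: hi; apply: val_inj.
rewrite IH; last exact: ltnW.
apply: eq_bigr => y _; rewrite !e; case: (go w s y) => [u|] //=.
rewrite /delta; case: ltnP => hu; last first.
  by rewrite (_ : Some u == Some t = false) //; apply/eqP => -[h]; lia.
rewrite !(inj_eq Some_inj).
by case: (nth false w u); rewrite /= !(inj_eq Some_inj) eqSS ?addn0.
Qed.

Lemma bval_trs w d s : s < size w -> bval (trs w d s) = walks w d s s.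
Proof. by move=> h; rewrite /trs -nth0 nth_drop addn0 walks_plist // ltnW. Qed.

Lemma bval_tr w d : bval (tr w d) = \sum_(s < size w) walks w d s s.
Proof.
rewrite /tr; suff h m o : m <= size w -> bval (iter m (tr_step w d) (m, o)).2 =
   bval o + \sum_(s < m) walks w d s s by rewrite h.
elim: m o => [|m IH] o hm; first by rewrite big_ord0 addn0.
rewrite iterSr {2}/tr_step /= IH; last exact: ltnW.
by rewrite bval_adds bval_trs // big_ord_recr /=; lia.
Qed.

Lemma bval_cnt w : bval (cnt w) = \sum_(k < size w) bval (tr w (gcdn k.+1 (size w))).
Proof.
rewrite /cnt; suff h m o : bval (iter m (cnt_step w) (m, o)).2 =
   bval o + \sum_(k < m) bval (tr w (gcdn k.+1 (size w))) by rewrite h.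
elim: m o => [|m IH] o; first by rewrite big_ord0 addn0.
rewrite iterSr {2}/cnt_step /= IH.
by rewrite bval_adds gcdbE big_ord_recr /=; lia.
Qed.

Lemma rot_iter k (x : seq bool) : k <= size x -> rot k x = iter k (rot 1) x.
Proof.
elim: k => [|k IH] h; first by rewrite rot0.
by rewrite iterS -IH ?(ltnW h) // -addn1 addnC rotD // addnC addn1.
Qed.

(** Bezout's identity for iterates of the rotation by one in one direction, divisibility in the
    other. *)
Lemma rot_gcd k (x : seq bool) : 0 < k <= size x ->
  (rot k x == x) = (rot (gcdn k (size x)) x == x).
Proof.
move=> /andP[k0 hk].
have hg : gcdn k (size x) <= size x.
  by apply: dvdn_leq (dvdn_gcdr _ _); apply: leq_trans hk.
have it a q : iter a (rot 1) x = x -> iter (q * a) (rot 1) x = x.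
  by move=> h; elim: q => // q IH; rewrite mulSn iterD IH h.
rewrite !rot_iter //; apply/eqP/eqP => h.
  case: (egcdnP (size x) k0) => km kn e _.
  have h1 := it _ km h; have h2 := it (size x) kn.
  rewrite -rot_iter // rot_size in h2.
  by move: h1; rewrite e addnC iterD h2.
by rewrite -(divnK (dvdn_gcdl k (size x))) it.
Qed.

(** A nonempty multiple [b] of the length of [a] that commutes with [a] begins with [a], and what
    remains of [b] commutes with [a] again. *)
Lemma rot_rep_eq (a b : seq bool) m : b ++ a = a ++ b -> size b = m * size a -> b = rep m a.
Proof.
elim: m b => [|m IH] b; first by move=> _ /size0nil.
rewrite mulSn => e hs.
have hb : b = a ++ drop (size a) b.
  rewrite -{1}(cat_take_drop (size a) b); congr (_ ++ _).
  have h := congr1 (take (size a)) e; rewrite (take_size_cat b (erefl _)) in h.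
  by rewrite -[RHS]h takel_cat // hs leq_addr.
rewrite {1}hb /rep /=; congr (_ ++ _); apply: IH; last by rewrite size_drop hs addKn.
by move/eqP: e; rewrite {1 2}hb -catA eqseq_cat // => /andP[_ /eqP].
Qed.

(** * Words above [w] as labels of closed walks *)

Section Count.
Variables (n' : nat) (w : seq bool).
Local Notation n := n'.+1.
Hypotheses (hn : size w = n) (hw : pren w).

Definition above : {set n.-tuple bool} := [set x : n.-tuple bool | [forall k : 'I_n.+1, ltx w (rot k x)]].

Lemma aboveP (x : n.-tuple bool) : reflect (forall k, ltx w (rot k x)) (x \in above).
Proof.
rewrite inE; apply: (iffP forallP) => h k; last exact: h.
have [hk|hk] := ltnP k n.+1; first exact: (h (Ordinal hk)).
by rewrite rot_oversize ?size_tuple 1?ltnW //; have := h ord0; rewrite rot0.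
Qed.

Lemma aboveE (x : n.-tuple bool) : (x \in above) = [exists s : 'I_n, go w s x == Some (s : nat)].
Proof.
have x0 : val x != [::] by rewrite -size_eq0 size_tuple.
have hx : size x = size w by rewrite size_tuple hn.
apply/aboveP/existsP => [h|[s /eqP h] k]; last exact: (go_fix_rot hw k hx x0 h).
have [|s hs] := ltx_fix hw _ hx h; first by rewrite hn.
have hlt := go_fix_lt x0 hs; rewrite hn in hlt.
by exists (Ordinal hlt); rewrite hs.
Qed.

Lemma sum_walks d : 0 < d ->
  \sum_(s < n) walks w d s s =
  #|[set y : d.-tuple bool | [exists s : 'I_n, go w s y == Some (s : nat)]]|.
Proof.
move=> d0; rewrite exchange_big /= -sum1_card [RHS]big_mkcond /=.
apply: eq_bigr => y _; rewrite inE.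
have y0 : val y != [::] by rewrite -size_eq0 size_tuple; case: (d) d0.
case: existsP => [[s /eqP h]|h].
  rewrite (bigD1 s) //= h eqxx big1 // => i /eqP hi.
  case: eqP => // h'; case: hi; apply: val_inj; exact: (go_fix_unique hw y0 h' h).
rewrite big1 // => i _; case: eqP => // h'; case: h; exists i; exact/eqP.
Qed.

(** The bijection sends [y] to its power of length [n]. If the power fixes [s], it also fixes the
    state reached from [s] by [y], since [y] commutes with its powers; by uniqueness that state is
    [s]. *)
Lemma card_fix d : 0 < d -> d %| n ->
  #|[set y : d.-tuple bool | [exists s : 'I_n, go w s y == Some (s : nat)]]| =
  #|[set x : n.-tuple bool | (x \in above) && (rot d x == x)]|.
Proof.
move=> d0 /dvdnP[m hm].
pose f (y : d.-tuple bool) : n.-tuple bool := insubd [tuple of nseq n false] (rep m y).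
have fE y : val (f y) = rep m y.
  by rewrite insubdK // -topredE /= size_rep size_tuple hm.
have m0 : 0 < m by case: (m) hm.
have finj : injective f.
  move=> y y' /(congr1 val); rewrite !fE => e; apply: val_inj.
  have := congr1 (take d) e; case: (m) m0 => // k _.
  by rewrite /rep /= !take_size_cat ?size_tuple.
rewrite -(card_imset _ finj); apply: eq_card => x; rewrite [RHS]inE aboveE.
have x0 : val x != [::] by rewrite -size_eq0 size_tuple.
apply/imsetP/andP => [[y]|[/existsP[s /eqP hs] hr]].
  rewrite inE => /existsP[s /eqP h] ->; rewrite !fE; split.
    by apply/existsP; exists s; apply/eqP; exact: go_rep.
  have -> : rep m y = y ++ rep m.-1 y by case: (m) m0.
  by rewrite -{1}(size_tuple y) rot_size_cat rep_comm.
have hd : d <= n by rewrite hm leq_pmull.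
pose y : d.-tuple bool := insubd [tuple of nseq d false] (take d x).
have yE : val y = take d x.
  by rewrite insubdK // -topredE /= size_take size_tuple; case: ltngtP hd => // ->.
have xE : val x = rep m y.
  rewrite -[LHS](cat_take_drop d) -yE.
  have -> : drop d x = rep m.-1 y.
    apply: rot_rep_eq; first by rewrite yE cat_take_drop; exact/eqP.
    by rewrite size_drop !size_tuple hm; case: (m) m0 => // k _; rewrite mulSn addKn.
  by case: (m) m0.
exists y; last by apply: val_inj; rewrite fE.
rewrite inE.
have h1 := hs; rewrite xE in h1.
have : go w s (y ++ rep m y) = go w s y by rewrite rep_comm go_cat h1.
rewrite go_cat; case e : (go w s y) => [s1|]; last first.
  by move: h1; case: (m) m0 => // k _; rewrite /rep /= go_cat e.
rewrite /= -xE => h2.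
have es := go_fix_unique hw x0 hs h2.
by apply/existsP; exists s; rewrite e -es.
Qed.

End Count.

(** * Rotations as a group action *)

Section Burnside.
Variable n' : nat.
Local Notation n := n'.+1.

(** ['I_n] serves as the additive group of integers modulo [n], hence the restriction to positive
    [n]. *)
Definition rot_act (x : n.-tuple bool) (k : 'I_n) : n.-tuple bool := [tuple of rot k x].

Lemma rot_act1 x : rot_act x 1%g = x.
Proof. by apply: val_inj; rewrite /= rot0. Qed.

Lemma rot_actM x a b : rot_act x (a * b)%g = rot_act (rot_act x a) b.
Proof.
apply: val_inj; rewrite /= rot_add_mod ?size_tuple ?(ltnW (ltn_ord _)) // addnC.
case: (ltngtP (b + a) n) => h; first by rewrite modn_small.
  have ha := ltn_ord a; have hb := ltn_ord b.
  rewrite -{1}(subnK (ltnW h)) modnDr modn_small //; lia.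
by rewrite h modnn rot0 rot_oversize ?size_tuple.
Qed.

Definition rot_action := TotalAction rot_act1 rot_actM.

Lemma orbit_rot x : orbit rot_action [set: 'I_n] x = necklace_of x.
Proof.
apply/setP=> y; rewrite inE; apply/orbitP/existsP => [[k _ <-]|[k /eqP e]].
  by exists (widen_ord (leqnSn n) k).
have [hk|hk] := ltnP k n.
  by exists (Ordinal hk); rewrite ?inE //; apply: val_inj; rewrite /= e.
exists 1%g; rewrite ?inE // [LHS]rot_act1; apply: val_inj; rewrite e.
by rewrite drop_oversize ?take_oversize ?size_tuple.
Qed.

Lemma necklace_refl (x : n.-tuple bool) : x \in necklace_of x.
Proof. by rewrite -orbit_rot orbit_refl. Qed.

Lemma necklace_eq (x y : n.-tuple bool) : y \in necklace_of x -> necklace_of y = necklace_of x.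
Proof. by rewrite -!orbit_rot => h; apply/eqP; rewrite orbit_eq_mem. Qed.

Lemma mem_necklace_rot k (x : n.-tuple bool) : k <= n -> [tuple of rot k x] \in necklace_of x.
Proof. by move=> hk; rewrite inE; apply/existsP; exists (Ordinal (hk : k < n.+1)). Qed.

Lemma in_necklaces (c : {set n.-tuple bool}) x : c \in necklaces n -> x \in c -> c = necklace_of x.
Proof. by move=> /imsetP[y _ ->] /necklace_eq. Qed.

Definition num_above (w : seq bool) : nat :=
  #|[set c in necklaces n | [forall (x | x \in c), ltx w (val x)]]|.

Lemma above_class w (x : n.-tuple bool) :
  (x \in above n' w) = [forall (y | y \in necklace_of x), ltx w (val y)].
Proof.
apply/aboveP/forall_inP => [h y|h k].
  by rewrite inE => /existsP[k /eqP ->]; apply: h.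
have [hk|hk] := leqP k n; first exact: (h _ (mem_necklace_rot x hk)).
by rewrite rot_oversize ?size_tuple 1?ltnW //; apply: h; exact: necklace_refl.
Qed.

Lemma num_aboveE w : num_above w = #|@necklace_of n @: above n' w|.
Proof.
apply: eq_card => c; rewrite inE; apply/andP/imsetP => [[/imsetP[x _ ->] h]|[x h ->]].
  by exists x => //; rewrite above_class.
by split; [exact: imset_f|rewrite -above_class].
Qed.

(** Burnside's lemma ([Frobenius_Cauchy]) on the rotation-invariant set [above], whose orbits are
    the necklaces counted by [num_above]. *)
Lemma num_above_mul w :
  \sum_(k < n) #|[set x : n.-tuple bool | (x \in above n' w) && (rot k x == x)]| = num_above w * n.
Proof.
have acts : [acts [set: 'I_n], on above n' w | rot_action].
  apply/actsP=> a _ x.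
  by rewrite !above_class (@necklace_eq x) // -orbit_rot mem_orbit ?inE.
have := Frobenius_Cauchy acts.
rewrite cardsT card_ord num_aboveE.
have -> : orbit rot_action [set: 'I_n] @: above n' w = @necklace_of n @: above n' w.
  by apply: eq_imset => x; rewrite orbit_rot.
move=> <-; apply: eq_big => [k|k _]; first by rewrite inE.
apply: eq_card => x; rewrite inE; apply/andP/setIP => -[h1 h2]; split=> //.
  by apply/afix1P; apply: val_inj; exact/eqP.
by move/afix1P: h2 => /(congr1 val) /= ->.
Qed.

Theorem bval_cnt_pren w : size w = n -> pren w -> bval (cnt w) = n * num_above w.
Proof.
move=> hn hw; rewrite mulnC -num_above_mul bval_cnt hn.
pose F k := #|[set x : n.-tuple bool | (x \in above n' w) && (rot k x == x)]|.
have -> : \sum_(k < n) bval (tr w (gcdn k.+1 n)) = \sum_(k < n) F k.+1.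
  apply: eq_bigr => k _; rewrite bval_tr hn.
  have g0 : 0 < gcdn k.+1 n by rewrite gcdn_gt0.
  rewrite sum_walks // card_fix ?dvdn_gcdr //.
  apply: eq_card => x; rewrite !inE; congr (_ && _).
  by rewrite [RHS](@rot_gcd k.+1 x) size_tuple // ltn_ord.
(* The algorithm sums over the shifts [1, ..., n], Burnside's lemma over [0, ..., n - 1]; the two
   end terms agree. *)
rewrite big_ord_recr [RHS]big_ord_recl addnC; congr (_ + _).
apply: eq_card => x; rewrite !inE rot0; congr (_ && (_ == _)).
by rewrite -[X in rot X _](size_tuple x) rot_size.
Qed.

End Burnside.

(** * Search *)

Lemma ltx_false_r x m : ltx x (nseq m false) = false.
Proof. by elim: m x => [|m IH] [|[] x] //=; apply: IH. Qed.

Lemma ltx_true_l m x : ltx (nseq m true) x = false.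
Proof. by elim: m x => [|m IH] [|[] x] //=; apply: IH. Qed.

Lemma ltx_cat2 p q a b : size p = size q ->
  ltx (p ++ a) (q ++ b) = ltx p q || ((p == q) && ltx a b).
Proof.
elim: p q => [|c p IH] [|d q] //= [hs]; rewrite eqseq_cons IH //.
by case: (c == d) => //=; rewrite orbF.
Qed.

Lemma split_at (u x : seq bool) : size u <= size x ->
  exists p y, x = p ++ y /\ size p = size (rev u).
Proof.
move=> h; exists (take (size u) x), (drop (size u) x).
by rewrite cat_take_drop size_takel // size_rev.
Qed.

Section Search.
Variable n' : nat.
Local Notation n := n'.+1.

Definition num_ge (v : seq bool) : nat :=
  #|[set c in necklaces n | [forall (x | x \in c), ~~ ltx (val x) v]]|.

Lemma num_ge_zero : num_ge (nseq n false) = num_necklaces n.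
Proof.
apply: eq_card => c; rewrite inE; case: (c \in _) => //=.
by apply/forall_inP => x _; apply/negbT; exact: (ltx_false_r _ n).
Qed.

Lemma num_above_true : num_above n' (nseq n true) = 0.
Proof.
apply/eqP; rewrite cards_eq0; apply/eqP/setP=> c; rewrite !inE.
apply/negP => /andP[/imsetP[x _ ->] /forall_inP /(_ x (necklace_refl x))].
by rewrite (ltx_true_l n).
Qed.

(** A necklace that makes the difference contains [w] itself. *)
Lemma num_ge_le (w : n.-tuple bool) : num_ge w <= (num_above n' w).+1.
Proof.
apply: (@leq_trans #|necklace_of w |: [set c in necklaces n | [forall (x | x \in c), ltx w (val x)]]|);
  last by rewrite cardsU1 -[X in _ <= X]add1n leq_add2r leq_b1.
apply: subset_leq_card; apply/subsetP=> c; rewrite !inE => /andP[hc /forall_inP h].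
rewrite hc /=; case: (boolP (w \in c)) => [/(in_necklaces hc) ->|hw]; first by rewrite eqxx.
apply/orP; right; apply/forall_inP => x hx.
have := @ltx_total w x; rewrite !size_tuple => /(_ erefl).
case: eqP => [e _|_ /(_ isT)]; last by rewrite (negbTE (h x hx)) orbF.
by move: hw; rewrite (val_inj e) hx.
Qed.

(** No word of length [n] lies strictly between these two. *)
Lemma num_above_ge_succ u m : (size u + m.+1 = n)%N ->
  num_above n' (catrev u (false :: nseq m true)) <= num_ge (catrev u (true :: nseq m false)).
Proof.
move=> hs; apply: subset_leq_card; apply/subsetP=> c; rewrite !inE => /andP[-> /forall_inP h] /=.
apply/forall_inP => x /h {h}; rewrite !catrevE.
have [|p [y [ex hp]]] := @split_at u (val x); first by rewrite size_tuple; lia.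
rewrite /= in ex *; rewrite ex !ltx_cat2 //; case/orP => [h1|/andP[/eqP <- h2]].
  rewrite (ltx_asym h1) /=; case: eqP h1 => [->|//]; by rewrite ltx_irr.
rewrite ltx_irr eqxx /=.
case: y h2 {ex} => [|[] y] //=; last by rewrite ltx_true_l.
by rewrite ltx_false_r.
Qed.

Lemma num_ge_not_pren u m : (size u + m.+1 = n)%N ->
  ~~ prenb (catrev u (false :: nseq m true)) ->
  num_ge (catrev u (false :: nseq m false)) <= num_ge (catrev u (true :: nseq m false)).
Proof.
move=> hs /prenbPn[r]; rewrite !catrevE => /ltxP[t [h1 h2 h3 h4 h5]].
apply: subset_leq_card; apply/subsetP=> c; rewrite !inE => /andP[hc /forall_inP h].
rewrite hc /=; apply/forall_inP => x hx; apply/negP => hlt.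
have [y ex] : exists y, val x = rev u ++ false :: y.
  have := h x hx; move: hlt.
  have [|p [y [ex hp]]] := @split_at u (val x); first by rewrite size_tuple; lia.
  rewrite /= in ex *; rewrite ex !ltx_cat2 // negb_or.
  case/orP => [-> //|/andP[/eqP -> h6]] _.
  case: y h6 {ex} => [|[] y] //=; first by rewrite ltx_false_r.
  by exists y.
rewrite size_drop size_cat /= size_nseq size_rev hs in h1.
rewrite size_cat /= size_nseq size_rev hs in h2.
rewrite nth_drop in h4.
have agree j s s' : j <= size u -> nth false (rev u ++ false :: s) j = nth false (rev u ++ false :: s') j.
  by rewrite !nth_cat size_rev; case: ltnP => // *; rewrite (_ : j - size u = 0) //; lia.
(* Behind [u0] the probe consists of ones, so the 0 at the deciding position [r + t] lies within
   [u0]. *)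
have hrt : r + t <= size u.
  rewrite leqNgt; apply/negP => hgt; move: h4; rewrite nth_cat size_rev ltnNge (ltnW hgt) /=.
  case e : (r + t - size u) => [|k]; first by lia.
  by rewrite /= nth_nseq; case: ifP => //; lia.
have hr : r <= n by lia.
have : [tuple of rot r x] \in c by rewrite (in_necklaces hc hx); exact: mem_necklace_rot.
move/h; apply/negP/negPn; apply/ltxP; exists t.
have hrot j : j <= t -> nth false (rot r x) j = nth false (rev u ++ false :: nseq m true) (r + j).
  move=> hj; rewrite /rot [LHS]nth_cat size_drop size_tuple; case: ltnP => [hh|]; last by lia.
  by rewrite nth_drop ex; apply: agree; lia.
split.
- by rewrite size_tuple.
- by rewrite size_cat /= size_nseq size_rev hs.
- move=> j hj; rewrite [LHS]hrot ?(ltnW hj) // -nth_drop h3 //; apply: agree; lia.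
- by rewrite [LHS]hrot.
- by rewrite -h5; apply: agree; lia.
Qed.

(** The wanted representative lies between the letters found completed by zeros and completed by
    ones. Both bounds are expressed by counts, so its existence need not be assumed. *)
Lemma search_inv i t J : i <= n -> bval t = n * J -> 0 < J <= num_necklaces n ->
  let st := iter i (search_step t) ([::], nseq n true) in
  [/\ size st.1 = i, st.2 = nseq (n - i) true,
      J <= num_ge (catrev st.1 (nseq (n - i) false)) &
      num_above n' (catrev st.1 (nseq (n - i) true)) < J].
Proof.
move=> hi ht /andP[J0 hJ]; elim: i hi => [|i IH] hi.
  by rewrite subn0 /=; split=> //; rewrite ?num_ge_zero // num_above_true.
have {IH} := IH (ltnW hi); rewrite iterS; case: (iter i _ _) => u v /= [h1 h2 h3 h4].
have em : n - i = (n - i.+1).+1 by lia.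
set m := n - i.+1 in em *; rewrite em /= in h2 h3 h4.
have hs : size u + m.+1 = n by rewrite -em h1; lia.
rewrite /search_step /probe h2 /=; split=> //; first by rewrite h1.
  case hp : (prenb _) => /=; last first.
    by apply: leq_trans h3 _; apply: num_ge_not_pren => //; rewrite hp.
  have hcnt s := @bval_cnt_pren n' _ s (elimT (prenbP _) hp).
  rewrite ltvE ht hcnt ?ltn_pmul2l //; last by rewrite catrevE size_cat /= size_nseq size_rev.
  by case: ltnP => //= hlt; apply: leq_trans hlt _; exact: num_above_ge_succ.
case hp : (prenb _) => //=.
have hcnt s := @bval_cnt_pren n' _ s (elimT (prenbP _) hp).
rewrite ltvE ht hcnt ?ltn_pmul2l //; last by rewrite catrevE size_cat /= size_nseq size_rev.
by case: (ltnP (num_above n' (catrev u (false :: nseq m true)))) => hh /=.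
Qed.

Theorem search_spec t J : bval t = n * J -> 0 < J <= num_necklaces n ->
  exists x : n.-tuple bool, [/\ val x = rev (search n t), num_above n' (val x) = J.-1 &
    forall y, y \in necklace_of x -> ~~ ltx (val y) (val x)].
Proof.
move=> ht hJ; have [h1 _ h3 h4] := search_inv (leqnn n) ht hJ.
rewrite subnn -/(search n t) in h1 h3 h4.
have sz : size (rev (search n t)) == n by rewrite size_rev h1.
pose x := Tuple sz; exists x.
have hge : J <= num_ge x by [].
have hab : num_above n' x < J by [].
have hle := num_ge_le x.
have hJ' : num_above n' x = J.-1 by move/andP: hJ => [J0 _]; lia.
split=> //.
(* A necklace counted by [num_ge x] but not by [num_above] has no word below [x] and one not above
   it, so it contains [x]. *)
have : exists2 c, c \in [set c in necklaces n | [forall (y | y \in c), ~~ ltx (val y) (val x)]] &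
    c \notin [set c in necklaces n | [forall (y | y \in c), ltx (val x) (val y)]].
  apply/subsetPn; apply: contraTN hge => /subset_leq_card; rewrite -ltnNge => h.
  exact: leq_ltn_trans h hab.
move=> [c]; rewrite !inE => /andP[hc /forall_inP h]; rewrite hc /= => /forallPn[y].
rewrite negb_imply => /andP[hy hn].
have eyx : y = x.
  apply: val_inj; apply/eqP; apply: contraT => ne.
  have := ltx_total _ ne; rewrite !size_tuple => /(_ erefl).
  by rewrite (negbTE (h y hy)) (negbTE hn).
by rewrite -eyx -(in_necklaces hc hy); exact: h.
Qed.

Lemma num_necklaces_above : num_necklaces n = (num_above n' (nseq n false)).+1.
Proof.
apply/eqP; rewrite eqn_leq; apply/andP; split.
  by have := num_ge_le [tuple of nseq n false]; rewrite num_ge_zero.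
apply: proper_card; apply/properP; split; first by apply/subsetP=> c; rewrite inE => /andP[].
pose z := [tuple of nseq n false]; exists (necklace_of z); first exact: imset_f.
rewrite inE negb_and; apply/orP; right; apply/forall_inP => /(_ z (necklace_refl z)).
by rewrite ltx_irr.
Qed.

(** The added [n] accounts for the necklace of the zero word, the only one not above that word. *)
Theorem too_large_spec t J : bval t = n * J ->
  ltv (adds (cnt (nseq n false)) (mulj n [:: true])) t = (num_necklaces n < J).
Proof.
move=> ht; rewrite ltvE bval_adds bval_mulj ht (@bval_cnt_pren n') ?size_nseq //; last first.
  by move=> r; rewrite ltx_false_r.
by rewrite num_necklaces_above -mulnDr ltn_pmul2l // addn1.
Qed.

End Search.

(** * Input and output *)

Record tev (E : Type) (F : flow E) (s : stacks) (r : seq tcell) (k : nat) (e : E)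
    (s' : stacks) (r' : seq tcell) : Prop :=
  Tev { tevP : forall l, zone l s ->
    exists l' k', [/\ k' <= k, zone l' s' & ev F (l, r) k' e (l', r')] }.

Lemma tev_le E (F : flow E) s r k k' e s' r' :
  tev F s r k e s' r' -> k <= k' -> tev F s r k' e s' r'.
Proof.
move=> h hk; split=> l hz; have [l' [k1 [h1 h2 h3]]] := tevP h hz.
by exists l', k1; split=> //; apply: leq_trans hk.
Qed.

Lemma tev_sev E (F : flow E) s m r k e s' :
  sev F s k e s' -> ~~ is_work m -> tev F s (m :: r) k e s' (m :: r).
Proof. by move=> h hm; split=> l hz; exact: (sevP h r hz hm). Qed.

Lemma tev_bind (E : finType) E' (F : flow E) (G : E -> flow E') s r k e s1 r1 k' e' s2 r2 :
  tev F s r k e s1 r1 -> tev (G e) s1 r1 k' e' s2 r2 -> tev (bind F G) s r (k + k') e' s2 r2.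
Proof.
move=> h1 h2; split=> l hz.
have [l1 [k1 [a1 b1 c1]]] := tevP h1 hz.
have [l2 [k2 [a2 b2 c2]]] := tevP h2 b1.
exists l2, (k1 + k2); split=> //; first exact: leq_add.
exact: ev_bind c1 c2.
Qed.

Lemma tev_seqf E (F : flow unit) (G : flow E) s r k s1 r1 k' e s2 r2 :
  tev F s r k tt s1 r1 -> tev G s1 r1 k' e s2 r2 -> tev (seqf F G) s r (k + k') e s2 r2.
Proof. exact: tev_bind. Qed.

Lemma tev_loop_exit (S : finType) E (F : S -> flow (S + E)) x s r k e s' r' :
  tev (F x) s r k (inr e) s' r' -> tev (loop F x) s r k e s' r'.
Proof.
move=> h; split=> l hz; have [l1 [k1 [a1 b1 c1]]] := tevP h hz.
by exists l1, k1; split=> //; apply: ev_loop_exit.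
Qed.

Lemma tev_loop_next (S : finType) E (F : S -> flow (S + E)) x s r k x' s1 r1 k' e s2 r2 :
  tev (F x) s r k (inl x') s1 r1 -> tev (loop F x') s1 r1 k' e s2 r2 ->
  tev (loop F x) s r (k + k') e s2 r2.
Proof.
move=> h1 h2; split=> l hz.
have [l1 [k1 [a1 b1 c1]]] := tevP h1 hz.
have [l2 [k2 [a2 b2 c2]]] := tevP h2 b1.
exists l2, (k1 + k2); split=> //; first exact: leq_add.
exact: ev_loop_next c1 c2.
Qed.

(** [sev] requires an explicit scanned cell; [ret] rewrites the cell it scans and so turns an empty
    right half into a [Blank]. *)
Definition norm (r : seq tcell) := head Blank r :: behead r.

Lemma tev_ret E (e : E) s r : tev (ret e) s r 1 e s (norm r).
Proof. by split=> l hz; exists l, 1; split=> //; apply: ev_act. Qed.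

Lemma tev_ret_norm E (e : E) s r : tev (ret e) s (norm r) 1 e s (norm r).
Proof. exact: (tev_ret e s (norm r)). Qed.

Definition one_cell : wcell := tops (mk [:: false] [:: true] [::] [::]).

(* Turning the consumed input cell into the new first cell of the zone shifts every
   nonempty track, hence pushes on A and on B at once. *)
Lemma tev_eat E (g : tcell -> E * tcell * move) c r e A B :
  g c = (e, Work one_cell, MoveR) ->
  tev (act g) (mk A B [::] [::]) (c :: r) 1 e (mk (false :: A) (true :: B) [::] [::]) r.
Proof.
move=> h; split=> l hz; exists (Work one_cell :: l), 1; split=> //.
  apply: zone_cons; first by apply/ffunP=> -[[|[|[|[|i]]]] hi] //; rewrite !ffunE.
  by congr (zone l _): hz; apply/ffunP=> -[[|[|[|[|i]]]] hi] //; rewrite !ffunE.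
by apply: ev_act; [exact: h|].
Qed.

(** An eaten cell leaves [false] on A, and one more [true] turns the code of [q] into that of
    [q.+1]. The [false] of the separator stays alone as the code of the empty digit list, and its
    token makes [n.+1] on track B. *)
Definition read_n : flow unit :=
  loop (fun _ : unit => bind
    (act (fun c => (if c is Bit _ then true else false, Work one_cell, MoveR)))
    (fun b : bool => seqf (ret tt)
       (if b then seqf (push tA true) (ret (inl tt)) else ret (inr tt)))) tt.

Definition bits_tape : seq bool -> seq tcell := map (@Bit wcell).

Lemma tev_read_n k q p rest M :
  2 * (k + q) + 2 <= M ->
  tev read_n (mk (code (enc q)) (nseq p true) [::] [::])
    (nseq k (Bit true) ++ Sep :: bits_tape rest) (k.+1 * (2 * M + 7)) tt
    (mk (false :: code (enc (k + q))) (nseq (k + p).+1 true) [::] [::]) (norm (bits_tape rest)).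
Proof.
elim: k q p => [|k IH] q p hM.
  rewrite mul1n; apply: tev_loop_exit.
  apply: (@tev_le _ _ _ _ (1 + (1 + 1))); last by lia.
  apply: tev_bind; first exact: tev_eat.
  apply: tev_seqf; first exact: tev_ret.
  exact: tev_ret_norm.
rewrite mulSn; apply: tev_loop_next; last first.
  by rewrite addSnnS -[(k.+1 + p).+1]/(k + p).+2 -addnS; apply: IH; lia.
apply: (@tev_le _ _ _ _ (1 + (1 + ((2 * M + 3) + 1)))); last by lia.
apply: tev_bind; first exact: tev_eat.
have e : norm (nseq k (Bit true) ++ Sep :: bits_tape rest) = nseq k (Bit true) ++ Sep :: bits_tape rest.
  by case: (k).
apply: tev_seqf; first exact: tev_ret.
rewrite e -e; apply: tev_seqf; last exact: tev_ret_norm.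
apply: tev_sev; last by case: (k).
apply: sev_push_le; rewrite ?mkE ?updE //=.
have := esize_nat q; rewrite /esize => ->; lia.
Qed.

(** The [false] left by the eaten cell becomes the last symbol of the digit's code. *)
Definition add_bit (b : bool) : flow unit :=
  if b then seqf (push tA false) (seqf (push tA true) (push tA true)) else push tA true.

Lemma sev_add_bit b A B M : size A + 3 <= M ->
  sev (add_bit b) (mk (false :: A) B [::] [::]) (6 * M + 9) tt
    (mk (true :: code (enc b) ++ A) B [::] [::]).
Proof.
move=> hM; case: b => /=.
  have -> : 6 * M + 9 = (2 * M + 3) + ((2 * M + 3) + (2 * M + 3)) by lia.
  do 2!(apply: sev_seqf; first by apply: sev_push_le; rewrite ?mkE ?updE //=; lia).
  by apply: sev_push_le; rewrite ?mkE ?updE //=; lia.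
apply: (@sev_le _ _ _ (2 * M + 3)); last by lia.
by apply: sev_push_le; rewrite ?mkE ?updE //=; lia.
Qed.

(* Track B holds one token for each digit of the index that may still be read. *)
Definition read_j : flow bool :=
  loop (fun _ : unit => bind
    (act (fun c => if c is Bit b then (Some b, Work one_cell, MoveR) else (None, c, Stay)))
    (fun o : option bool => if o is Some b then
        seqf (ret tt) (bind (pop tB) (fun _ => bind (pop tB) (fun o : option bool =>
          if o is None then ret (inr false) else seqf (add_bit b) (ret (inl tt)))))
      else ret (inr true))) tt.

Definition read_cost M := 10 * M + 20.

Lemma norm_nonwork bs : ~~ is_work (head Blank (bits_tape bs)).
Proof. by case: bs. Qed.

(** The first pop from B undoes the token pushed by eating the cell, the second spends one prepared
    by [read_n]. *)
Lemma tev_read_bit b bs acc X p M : 4 * size acc + size X + 7 <= M -> p + 3 <= M ->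
  let A := code (enc (acc : seq bool)) ++ X in
  exists A', tev (bind
    (act (fun c => if c is Bit b then (Some b, Work one_cell, MoveR) else (None, c, Stay)))
    (fun o : option bool => if o is Some b then
        seqf (ret tt) (bind (pop tB) (fun _ => bind (pop tB) (fun o : option bool =>
          if o is None then ret (inr false) else seqf (add_bit b) (ret (inl tt)))))
      else ret (inr true)))
   (mk A (nseq p true) [::] [::]) (norm (bits_tape (b :: bs))) (read_cost M)
   (if p is 0 then inr false else inl tt) (mk A' (nseq p.-1 true) [::] [::]) (norm (bits_tape bs))
   /\ (0 < p -> A' = code (enc (b :: acc)) ++ X).
Proof.
move=> hA hp A.
have sA : size A + 6 <= M.
  by rewrite /A size_cat -/(esize acc); have := esize_bits acc; lia.
case: p hp => [|p] hp.
  exists (false :: A); split=> //.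
  apply: (@tev_le _ _ _ _ (1 + (1 + ((2 * M + 3) + ((2 * M + 3) + 1))))); last by rewrite /read_cost; lia.
  apply: tev_bind; first exact: tev_eat.
  apply: tev_seqf; first exact: tev_ret.
  apply: tev_bind.
    by apply: tev_sev (norm_nonwork _); apply: sev_pop_le; rewrite ?mkE ?updE //=; lia.
  apply: tev_bind.
    by apply: tev_sev (norm_nonwork _); apply: sev_pop_le; rewrite ?mkE ?updE //=; lia.
  by rewrite ?mkE ?updE /=; apply: tev_ret_norm.
exists (code (enc (b :: acc)) ++ X); split=> //.
apply: (@tev_le _ _ _ _ (1 + (1 + ((2 * M + 3) + ((2 * M + 3) + ((6 * M + 9) + 1)))))); last by rewrite /read_cost; lia.
apply: tev_bind; first exact: tev_eat.
apply: tev_seqf; first exact: tev_ret.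
apply: (tev_bind (e := Some true)).
  by apply: tev_sev (norm_nonwork _); apply: sev_pop_le; rewrite ?mkE ?updE //= size_nseq; lia.
apply: (tev_bind (e := Some true)).
  by apply: tev_sev (norm_nonwork _); apply: sev_pop_le; rewrite ?mkE ?updE //= size_nseq; lia.
rewrite ?mkE ?updE; apply: tev_seqf; last exact: tev_ret_norm.
apply: tev_sev (norm_nonwork _).
have -> : code (enc (b :: acc)) ++ X = true :: code (enc b) ++ A by rewrite code_cons /= catA.
by apply: sev_add_bit; lia.
Qed.

Lemma tev_read_j bs acc X p M : size bs <= p ->
  4 * (size bs + size acc) + size X + 7 <= M -> p + 3 <= M ->
  tev read_j (mk (code (enc acc) ++ X) (nseq p true) [::] [::]) (norm (bits_tape bs))
    ((size bs).+1 * read_cost M) true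
    (mk (code (enc (catrev bs acc)) ++ X) (nseq (p - size bs) true) [::] [::]) [:: Blank].
Proof.
elim: bs acc p => [|b bs IH] acc p hp hM hpM.
  rewrite mul1n subn0; apply: tev_loop_exit.
  apply: (@tev_le _ _ _ _ (1 + 1)); last by rewrite /read_cost; lia.
  apply: (tev_bind (e := None)); last exact: (tev_ret _ _ [:: Blank]).
  by split=> l hz; exists l, 1; split=> //; apply: ev_act.
have [|A' [h1 /(_ _) h2]] := @tev_read_bit b bs acc X p M _ hpM.
  by rewrite /= in hM; lia.
case: p hp hpM h1 h2 => // p hp hpM h1 h2; rewrite h2 // in h1.
rewrite [size _]/= mulSn; apply: tev_loop_next h1 _.
rewrite subSS; apply: IH => //; first by rewrite /= in hM *; lia.
by lia.
Qed.

(** The time depends on the number [p] of tokens, not on the length of [bs]. *)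
Lemma tev_read_j_long bs (acc : seq bool) X p M : p < size bs ->
  4 * (p + size acc) + size X + 7 <= M -> p + 3 <= M ->
  exists s r, tev read_j (mk (code (enc acc) ++ X) (nseq p true) [::] [::]) (norm (bits_tape bs))
    (p.+1 * read_cost M) false s r.
Proof.
elim: bs acc p => // b bs IH acc p hp hM hpM.
have [|A' [h1 h2]] := @tev_read_bit b bs acc X p M _ hpM; first by lia.
case: p hp hM hpM h1 h2 => [|p] hp hM hpM h1 h2.
  by eexists; eexists; rewrite mul1n; apply: tev_loop_exit; exact: h1.
rewrite h2 // in h1.
have [|||s [r h]] := IH (b :: acc) p; [by []|by rewrite /=; lia|by lia|].
exists s, r; rewrite mulSn; apply: tev_loop_next h1 _; exact: h.
Qed.

Definition drain : flow unit :=
  loop (fun _ : unit => bind (pop tB) (fun o : option bool =>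
    ret (if o is Some _ then inl tt else inr tt))) tt.

Lemma sev_drain A p M : p <= M ->
  sev drain (mk A (nseq p true) [::] [::]) (p.+1 * (2 * M + 4)) tt (main A).
Proof.
elim: p => [|p IH] hp.
  rewrite mul1n; apply: sev_loop_exit.
  have -> : 2 * M + 4 = (2 * M + 3) + 1 by lia.
  apply: sev_bind; first by apply: sev_pop_le; rewrite ?mkE ?updE.
  by rewrite ?mkE ?updE /=; exact: sev_ret.
rewrite mulSn; apply: sev_loop_next (IH (ltnW hp)).
have -> : 2 * M + 4 = (2 * M + 3) + 1 by lia.
apply: (sev_bind (e := Some true)); last exact: sev_ret.
by apply: sev_pop_le; rewrite ?mkE ?updE //= size_nseq.
Qed.

(** Overwriting the first cell of the zone by an output letter pops every track at once, so the top
    of A must be a symbol to be discarded. *)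
Definition emit_bit (b : bool) : flow (unit + unit) :=
  seqf goleft (act (fun _ => (inl tt, Bit b, Stay))).

Lemma tev_emit_bit b A m r :
  tev (emit_bit b) (main (false :: A)) (m :: r) 2 (inl tt) (main A) [:: Bit b, m & r].
Proof.
split=> l hz; exists (behead l), (1 + 1); split=> //.
  by congr (zone _ _): (zone_behead hz); apply/ffunP=> -[[|[|[|[|i]]]] hi] //; rewrite !ffunE.
by apply: ev_bind; [exact: ev_act|exact: ev_act].
Qed.

(** The output grows leftwards into cells given up by the zone. One [false] of the letter's code is
    lost with the cell: [true] has one left after two pops, for [false] it is put back. *)
Definition write_out : flow unit :=
  loop (fun _ : unit => bind (pop tA) (fun o : option bool =>
    if o is Some true then
      bind (pop tA) (fun o : option bool =>
        if o is Some true then bind (pop tA) (fun _ => emit_bit true)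
        else seqf (push tA false) (emit_bit false))
    else ret (inr tt))) tt.

Lemma tev_write_out bs out M : esize (bs : seq bool) <= M ->
  tev write_out (main (code (enc bs))) (bits_tape out ++ [:: Blank])
   ((size bs).+1 * (6 * M + 11)) tt (main [::]) (bits_tape (catrev bs out) ++ [:: Blank]).
Proof.
have hm o : ~~ is_work (head Blank (bits_tape o ++ [:: Blank])) by case: o.
have hn o : bits_tape o ++ [:: Blank] = norm (bits_tape o ++ [:: Blank]) by case: o.
elim: bs out => [|b bs IH] out hM.
  rewrite mul1n; apply: tev_loop_exit; apply: (@tev_le _ _ _ _ ((2 * M + 3) + 1)); last by lia.
  rewrite hn; apply: tev_bind.
    by apply: tev_sev (hm _); apply: sev_pop_le; rewrite ?mkE ?updE.
  by rewrite ?mkE ?updE /=; exact: tev_ret_norm.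
rewrite esize_cons in hM.
rewrite [size _]/= mulSn; apply: tev_loop_next; last by apply: (IH (b :: out)); lia.
have he b' A : tev (emit_bit b') (main (false :: A)) (norm (bits_tape out ++ [:: Blank])) 2
    (inl tt) (main A) (bits_tape (b' :: out) ++ [:: Blank]).
  have -> : bits_tape (b' :: out) ++ [:: Blank] = Bit b' :: norm (bits_tape out ++ [:: Blank]).
    by rewrite -hn.
  exact: tev_emit_bit.
rewrite [in X in tev _ _ X]hn code_cons; case: b hM => hM.
  have hM' : 4 + esize bs <= M by move: hM; rewrite {1}/esize /=; lia.
  apply: (@tev_le _ _ _ _ ((2 * M + 3) + ((2 * M + 3) + ((2 * M + 3) + 2)))); last by lia.
  do 3!(apply: tev_bind; first by apply: tev_sev (hm _); apply: sev_pop_le;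
    rewrite ?mkE ?updE //= -/(esize bs); lia).
  by rewrite ?mkE ?updE /=; exact: he.
have hM' : 2 + esize bs <= M by move: hM; rewrite {1}/esize /=; lia.
apply: (@tev_le _ _ _ _ ((2 * M + 3) + ((2 * M + 3) + ((2 * M + 3) + 2)))); last by lia.
do 2!(apply: tev_bind; first by apply: tev_sev (hm _); apply: sev_pop_le;
    rewrite ?mkE ?updE //= -/(esize bs); lia).
rewrite ?mkE ?updE /=; apply: tev_seqf.
  by apply: tev_sev (hm _); apply: sev_push_le; rewrite ?mkE ?updE //= -/(esize bs); lia.
exact: he.
Qed.

Definition emit : flow bool :=
  bind (pop tA) (fun _ => bind (pop tA) (fun o : option bool =>
    if o is Some false then seqf write_out (ret false) else ret true)).

Lemma tev_emit (big : bool) (bs : seq bool) M : esize (big, bs) <= M ->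
  exists s r, tev emit (main (code (enc (big, bs)))) [:: Blank]
    ((M.+1) * (6 * M + 11) + (4 * M + 7)) big s r /\ (~~ big -> out_bits r = rev bs).
Proof.
move=> hM.
have hs : size bs <= M.
  by have := @size_le_esize _ enc_bool bs; rewrite esize_pair in hM; lia.
have hb : esize bs <= M by rewrite esize_pair in hM; lia.
case: big hM => hM.
  do 2!eexists; split=> //.
  apply: (@tev_le _ _ _ _ ((2 * M + 3) + ((2 * M + 3) + 1))); last by lia.
  apply: tev_bind; first by apply: (tev_sev (m := Blank)) => //; apply: sev_pop_le;
    rewrite ?mkE ?updE //; exact: hM.
  apply: (tev_bind (e := Some true)); last exact: tev_ret.
  apply: (tev_sev (m := Blank)) => //; apply: sev_pop_le; rewrite ?mkE ?updE //=.
  by rewrite esize_pair {1}/esize /= in hM; rewrite -/(esize bs); lia.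
exists (main [::]), (bits_tape (catrev bs [::]) ++ [:: Blank]); split; last first.
  by move=> _; rewrite /rev; elim: (catrev _ _) => //= b s ->.
apply: (@tev_le _ _ _ _ ((2 * M + 3) + ((2 * M + 3) + ((size bs).+1 * (6 * M + 11) + 1)))); last first.
  have : (size bs).+1 * (6 * M + 11) <= M.+1 * (6 * M + 11) by rewrite leq_mul2r; apply/orP; right.
  by lia.
apply: tev_bind; first by apply: (tev_sev (m := Blank)) => //; apply: sev_pop_le;
    rewrite ?mkE ?updE //; exact: hM.
apply: (tev_bind (e := Some false) (s1 := main (code (enc bs)))).
  apply: (tev_sev (m := Blank)) => //; apply: sev_pop_le; rewrite ?mkE ?updE //=.
  by rewrite esize_pair {1}/esize /= in hM; rewrite -/(esize bs); lia.
apply: tev_seqf; first exact: (tev_write_out [::] hb).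
have -> : bits_tape (catrev bs [::]) ++ [:: Blank] = norm (bits_tape (catrev bs [::]) ++ [:: Blank]).
  by case: (catrev _ _).
exact: tev_ret_norm.
Qed.

Lemma bval_bin_pos j : bval (bin_pos j) = Pos.to_nat j.
Proof. by elim: j => //= j ->; lia. Qed.

Lemma bin_pos_ge j : 2 ^ (size (bin_pos j)).-1 <= Pos.to_nat j.
Proof.
have h k : 0 < size (bin_pos k) by case: k.
elim: j => [j IH|j IH|] //=; have := h j; case: (size _) IH => // s IH _;
  rewrite /= expnS in IH *; lia.
Qed.

Lemma num_necklaces_le n : num_necklaces n <= 2 ^ n.
Proof.
by apply: leq_trans (leq_imset_card _ _) _; rewrite card_tuple card_bool.
Qed.

Section Machine.
Variable F : flow unit.

(** The first [false] is the code of 0, from which [read_n] counts; the later [true] joins the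
    digits and [n], adjacent on A, into a pair. The final exit is the flag for too large an
    index. *)
Definition main_flow : flow bool :=
  seqf (push tA false) (seqf read_n (bind read_j (fun ok : bool =>
    if ok then seqf drain (seqf (push tA true) (seqf F emit)) else ret true))).

(** At most [n.+1] digits of size at most 4 and a unary [n] of size [2 * n + 1], with slack for the
    stack operations. *)
Definition len_bound n := 6 * n + 20.

Definition run_bound k n :=
  let M := len_bound n in let S := bnd k M in
  3 + (n.+1 * (2 * M + 7) + (n.+2 * read_cost M +
    (n.+2 * (2 * M + 4) + ((2 * M + 3) + (bnd k M + (S.+1 * (6 * S + 11) + (4 * S + 7))))))).

Lemma zone_nil : zone [::] (main [::]).
Proof. by apply/ffunP=> -[[|[|[|[|i]]]] hi] //; rewrite !ffunE. Qed.

Lemma tev_prefix n bs r' s' e k :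
  tev (bind read_j (fun ok : bool =>
    if ok then seqf drain (seqf (push tA true) (seqf F emit)) else ret true))
    (mk (code (enc ([::] : seq bool)) ++ code (enc n)) (nseq n.+1 true) [::] [::])
    (norm (bits_tape bs)) k e s' r' ->
  tev main_flow (main [::]) (nseq n (Bit true) ++ Sep :: bits_tape bs)
    (3 + (n.+1 * (2 * len_bound n + 7) + k)) e s' r'.
Proof.
have e0 : nseq n (Bit true) ++ Sep :: bits_tape bs = norm (nseq n (Bit true) ++ Sep :: bits_tape bs).
  by case: n.
move=> h; apply: tev_seqf.
  rewrite [X in tev _ _ X]e0; apply: tev_sev; last by case: (n).
  by apply: (@sev_push_le _ _ _ (main [:: false]) 0); rewrite ?mkE ?updE.
rewrite -/(norm _) -e0; apply: tev_seqf h.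
have := @tev_read_n n 0 0 bs (len_bound n); rewrite !addn0; apply.
by rewrite /len_bound; lia.
Qed.

Lemma tev_main_long n bs : n.+1 < size bs -> forall k,
  exists s r, tev main_flow (main [::]) (nseq n (Bit true) ++ Sep :: bits_tape bs)
    (run_bound k n) true s r.
Proof.
move=> hbs k.
have [||s [r h]] := @tev_read_j_long bs [::] (code (enc n)) n.+1 (len_bound n) hbs.
- by rewrite -/(esize n) esize_nat /len_bound /=; lia.
- by rewrite /len_bound; lia.
exists s, (norm r); apply: tev_le.
  by apply: tev_prefix; apply: tev_bind h _; exact: tev_ret.
by rewrite /run_bound; lia.
Qed.

Lemma tev_main_short k n bs :
  (forall x, esize (index_necklace x) <= bnd k (esize x) /\
    forall rest, sev F (main (code (enc x) ++ rest)) (bnd k (esize x + size rest)) tt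
                  (main (code (enc (index_necklace x)) ++ rest))) ->
  size bs <= n.+1 ->
  exists s r, tev main_flow (main [::]) (nseq n (Bit true) ++ Sep :: bits_tape bs)
    (run_bound k n) (index_necklace (rev bs, n)).1 s r /\
    (~~ (index_necklace (rev bs, n)).1 -> out_bits r = rev (index_necklace (rev bs, n)).2).
Proof.
move=> hF hbs; have [hs hF'] := hF (rev bs, n).
case: (index_necklace _) hs hF' => big u hs hF'.
have hx : esize (rev bs, n) <= len_bound n.
  rewrite esize_pair esize_nat /len_bound; have := esize_bits (rev bs); rewrite size_rev; lia.
have hu : esize (big, u) <= bnd k (len_bound n) by apply: leq_trans hs (bnd_mono _ hx).
have [s [r [h1 h2]]] := tev_emit hu.
exists s, r; split=> //.
rewrite /run_bound; apply: tev_prefix; apply: (@tev_bind _ _ _ _ _ _ _ true).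
  apply: tev_le; first apply: (@tev_read_j bs [::] (code (enc n)) n.+1 (len_bound n)) => //.
  - by rewrite addn0 -/(esize n) esize_nat /len_bound; lia.
  - by rewrite /len_bound; lia.
  by rewrite leq_mul2r ltnS hbs orbT.
have hsz : size (code (enc (rev bs)) ++ code (enc n)) <= len_bound n.
  by rewrite size_cat -/(esize (rev bs)) -/(esize n); rewrite esize_pair in hx; lia.
apply: tev_seqf.
  apply: (tev_sev (m := Blank)) => //; apply: sev_le.
    by apply: (@sev_drain _ _ (len_bound n)); rewrite /len_bound; lia.
  by rewrite leq_mul2r; apply/orP; right; lia.
apply: tev_seqf.
  by apply: (tev_sev (m := Blank)) => //; apply: sev_push_le; rewrite ?mkE ?updE //; exact: hsz.
apply: tev_seqf; last exact: h1.
apply: (tev_sev (m := Blank)) => //.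
have := hF' [::]; rewrite !cats0 addn0 => h; apply: sev_le h _; exact: bnd_mono.
Qed.

End Machine.

Lemma polyb_run_bound k : polyb (run_bound k).
Proof. rewrite /run_bound /read_cost /len_bound; polyb. Qed.

Definition rep_string n (j : nat) : seq bool :=
  rev (index_necklace (rev (bin_pos (Pos.of_nat j)), n)).2.

Definition nth_rep n (j : nat) : n.-tuple bool :=
  insubd [tuple of nseq n false] (rep_string n j).

Lemma too_large_num n j : size (bin_pos j) <= n.+1 ->
  (index_necklace (rev (bin_pos j), n)).1 = (num_necklaces n < Pos.to_nat j).
Proof.
case: n => [|n] hs; last first.
  by apply: too_large_spec; rewrite bval_mulj revK bval_bin_pos.
(* For [n = 0] both sides of the test are multiplied by 0. The answer [false] is right: there is one
   necklace, and an index of one digit is 1. *)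
have -> : (index_necklace (rev (bin_pos j), 0)).1 = false by [].
case: j hs => [j|j|] /=; [by case: j|by case: j|] => _; apply/esym/negbTE; rewrite -leqNgt.
by apply/card_gt0P; exists (necklace_of [tuple]); exact: imset_f.
Qed.

Lemma nth_repS n j : 0 < j <= num_necklaces n.+1 ->
  [/\ val (nth_rep n.+1 j) = rep_string n.+1 j, num_above n (nth_rep n.+1 j) = j.-1 &
    forall y, y \in necklace_of (nth_rep n.+1 j) -> ~~ ltx (val y) (val (nth_rep n.+1 j))].
Proof.
move=> hj; have j0 : j <> 0 by case/andP: hj; lia.
have ht : bval (mulj n.+1 (rev (rev (bin_pos (Pos.of_nat j))))) = n.+1 * j.
  by rewrite revK bval_mulj bval_bin_pos Nat2Pos.id.
have [x [h1 h2 h3]] := search_spec ht hj.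
suff -> : nth_rep n.+1 j = x by [].
by apply: val_inj; rewrite /nth_rep insubdK ?h1 // -topredE /= /rep_string -h1 size_tuple.
Qed.

Lemma val_nth_rep n j : 0 < j <= num_necklaces n -> val (nth_rep n j) = rep_string n j.
Proof.
case: n => [|n] hj; last by have [] := nth_repS hj.
by rewrite /nth_rep insubdK.
Qed.

(** Representatives of the same necklace are both least in it, hence equal, and [num_above] recovers
    the index. *)
Lemma nth_rep_inj n :
  injective (fun i : 'I_(num_necklaces n) => necklace_of (nth_rep n i.+1)).
Proof.
case: n => [|n] i i' /= e.
  have := num_necklaces_le 0; have := ltn_ord i; have := ltn_ord i'.
  by move=> *; apply: val_inj => /=; lia.
have [_ h1 h2] := @nth_repS n i.+1 (ltn_ord i).
have [_ h1' h2'] := @nth_repS n i'.+1 (ltn_ord i').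
have l1 := h2 (nth_rep n.+1 i'.+1); rewrite e in l1; have {}l1 := l1 (necklace_refl _).
have l2 := h2' (nth_rep n.+1 i.+1); rewrite -e in l2; have {}l2 := l2 (necklace_refl _).
apply: val_inj => /=; rewrite -[LHS]/(i.+1.-1) -[RHS]/(i'.+1.-1) -h1 -h1'.
congr (num_above _ _); apply/eqP; apply: contraT => ne.
by have := ltx_total _ ne; rewrite !size_tuple (negbTE l1) (negbTE l2) => /(_ erefl).
Qed.

Theorem theorem4 :
  exists (M : TM) (c d : nat)
         (f : forall n : nat, 'I_(num_necklaces n) -> {set n.-tuple bool}),
    (forall n, injective (f n)) /\
    (forall n i, f n i \in necklaces n) /\
    (forall n C, C \in necklaces n -> exists i, f n i = C) /\
    (forall (n : nat) (j : positive),
       let cfg := @run M (c * n.+1 ^ d) (@init_config M n j) in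
       @tm_halted M (cfg_state cfg) /\
       (if (Pos.to_nat j <= num_necklaces n)%N then
          ~~ @tm_too_large M (cfg_state cfg) /\
          exists (i : 'I_(num_necklaces n)) (t : n.-tuple bool),
            nat_of_ord i = (Pos.to_nat j).-1 /\
            val t = cfg_output cfg /\ t \in f n i
        else @tm_too_large M (cfg_state cfg))).
Proof.
have [F [k hF]] := ptime_index_necklace.
have [K hK] := polyb_run_bound k.
have hb n : run_bound k n <= 2 ^ K * n.+1 ^ K by apply: leq_trans (hK n) (bnd_le _ _).
pose f n (i : 'I_(num_necklaces n)) := necklace_of (nth_rep n i.+1).
have fn n i : f n i \in necklaces n by exact: imset_f.
exists (@machine bool id (main_flow F)), (2 ^ K), K, f; split; first exact: nth_rep_inj.
split=> //; split.
  move=> n C hC; suff: C \in [set f n i | i : 'I_(num_necklaces n)].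
    by case/imsetP => i _ ->; exists i.
  (* An injective image with as many elements as there are necklaces is everything. *)
  suff -> : [set f n i | i : 'I_(num_necklaces n)] = necklaces n by [].
  apply/eqP; rewrite eqEcard; apply/andP; split.
    by apply/subsetP=> D /imsetP[i _ ->]; exact: fn.
  by rewrite (card_imset _ (@nth_rep_inj n)) card_ord.
move=> n j; have j0 : 0 < Pos.to_nat j by lia.
have hrun e s r : tev (main_flow F) (main [::]) (nseq n (Bit true) ++ Sep :: bits_tape (bin_pos j))
    (run_bound k n) e s r ->
    exists l, @run (machine id (main_flow F)) (2 ^ K * n.+1 ^ K) (init_config _ n j) = (inr e, l, r).
  move=> h; have [l [k' [h1 _ h2]]] := tevP h zone_nil; exists l.
  exact: (runs_machine id h2 (leq_trans h1 (hb n))).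
(* More than [n.+1] digits mean [j >= 2 ^ n.+1], beyond the number of necklaces. *)
have [hs|hs] := leqP (size (bin_pos j)) n.+1; last first.
  have [s [r /hrun[l ->]]] := tev_main_long F hs k; split=> //=.
  rewrite leqNgt ifF //; apply/negbF.
  apply: leq_ltn_trans (num_necklaces_le n) _; apply: leq_trans (bin_pos_ge j).
  by rewrite ltn_exp2l //; lia.
have [s [r]] := tev_main_short hF hs; rewrite too_large_num // => -[/hrun[l ->] hr].
split=> //; rewrite /cfg_state /=; case: leqP hr => // hj /(_ isT) hr; split=> //.
have hi : (Pos.to_nat j).-1 < num_necklaces n by lia.
exists (Ordinal hi), (nth_rep n (Pos.to_nat j)); split=> //; split.
  by rewrite val_nth_rep ?j0 // /rep_string Pos2Nat.id /cfg_output -hr.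
rewrite /f /= prednK // inE; apply/existsP; exists ord0.
by rewrite drop0 take0 cats0.
Qed.
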